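(* Let $\mu\in\mathbb{C}\setminus\{0\}$ and $\mathbb{L}=\{(s,\lambda)\in\mathbb{C}^2\mid\Re\lambda>0,\ \lambda(j-s)\ne(2k+1)\pi i\ \text{for all } j,k\in\mathbb{Z},\ j\ge1\}$. For all $m\in\mathbb{N}$ and all $(s_0,\lambda)\in\mathbb{L}$, with the Taylor projection $\iota_m$ taken about $s_0+k$, let $$A_\mu^m=\lim_{k\to\infty}\left\|\frac{1}{\mu\beta(s+k)}\right\|_{\mathcal{N},m},$$ where $\mathcal{N}$ is a neighborhood of $s_0$. If $\Re\lambda>\ln A_\mu^m$, then there exists $K$ such that for all $k>K$ $$\lim_{n\to\infty}\tau^n(s+k)=\tau(s+k)\quad\text{under the norm } \|\cdot\|_{\mathcal{N},m}.$$
   Context: For $j\ge 1$ let $q_j(s,z)=\dfrac{e^{\mu z}}{1+e^{\lambda(j-s)}}$ and $\beta(s)=\beta_{\lambda,\mu}(s)=\lim_{n\to\infty}q_1(s,q_2(s,\dots q_n(s,z)\dots))$ (nested in $z$; independent of $z$), which is holomorphic for $(s,\lambda)\in\mathbb{L}$ and satisfies $\beta(s+1)=e^{\mu\beta(s)}/(1+e^{-\lambda s})$. Write $\log w=\ln(w)/\mu$, with $\ln(1+x)$ the branch vanishing at $x=0$. Define $\tau^0=0$ and $\tau^{n+1}(s)=\log\left(1+\frac{\tau^n(s+1)}{\beta(s+1)}\right)-\log(1+e^{-\lambda s})$. For a function $a$ holomorphic near a centre $c$, $\iota_m(a)$ is its Taylor polynomial of order $m$ about $c$, i.e. $\iota_m\big(\sum_{j\ge0}a_j(s-c)^j\big)=\sum_{j=0}^m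 a_j(s-c)^j$, and $\|a\|_{\mathcal{N},m}=\|\iota_m(a)\|_{\mathcal{N}}$ (supremum norm). With the centre $s_0+k$ this reads $$\|a(s+k)\|_{\mathcal{N},m}=\sup_{s\in\mathcal{N}}\left|\sum_{j=0}^m a^{(j)}(s_0+k)\frac{(s-s_0)^j}{j!}\right|,$$ where $\mathcal{N}$ is a small neighborhood of $s_0$ (in particular with $|s-s_0|\le1$ on $\mathcal{N}$). Convergence $\tau^n(s+k)\to\tau(s+k)$ under this norm means that the order-$m$ Taylor polynomials of $\tau^n$ about $s_0+k$ converge; $\tau(s+k)$ then stands for the limit polynomial modulo $\mathcal{O}((s-s_0)^{m+1})$ ($\tau$ itself is not assumed holomorphic). *)

(* Defs.v *)
(* MathComp-Analysis; the complex numbers are R[i] over R : realType, and R[i]^o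
   is R[i] seen as a normed space over itself, so that [derive1n] and
   [derivable] below are complex differentiation. *)
From mathcomp Require Import all_boot all_order all_algebra.
From mathcomp Require Import all_classical all_reals all_analysis.
From mathcomp Require Export complex.
Import numFieldNormedType.Exports.
Import Order.TTheory GRing.Theory Num.Theory.

Set Implicit Arguments.
Unset Strict Implicit.
Unset Printing Implicit Defensive.

Local Open Scope classical_set_scope.
Local Open Scope ring_scope.
Local Open Scope complex_scope.

Section Defs.
Variable R : realType.
Implicit Types (s c z w mu lambda : R[i]) (a : R[i] -> R[i]) (N : set R[i]).

Definition cabs z : R := ComplexField.Normc.normc z.

Definition cexp z : R[i] :=
  (expR (complex.Re z))%:C * (cos (complex.Im z) +i* sin (complex.Im z)).

(* Principal argument, in ]-pi, pi]: off the negative real axis it is given by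
   the half-angle formula tan (arg / 2) = Im z / (|z| + Re z). *)
Definition carg z : R :=
  if (complex.Im z == 0) && (complex.Re z < 0) then pi
  else 2 * atan (complex.Im z / (cabs z + complex.Re z)).

(* Principal branch; ln (1 + x) vanishes at x = 0. *)
Definition cln z : R[i] := ln (cabs z) +i* carg z.

Definition clog mu w : R[i] := cln w / mu.

Definition LL : set (R[i] * R[i]) :=
  [set p | 0 < complex.Re p.2 /\
    forall j k : int, 1 <= j ->
      p.2 * (j%:~R - p.1) <> (2 * k + 1)%:~R * (pi : R)%:C * 'i].

Definition q mu lambda (j : nat) s z : R[i] :=
  cexp (mu * z) / (1 + cexp (lambda * (j%:R - s))).

(* q_1(s, q_2(s, ... q_n(s, z))) *)
Definition q_nest mu lambda (n : nat) s z : R[i] :=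
  foldr (fun j w => q mu lambda j s w) z (iota 1 n).

(* The limit does not depend on the seed z, which is kept as a parameter. *)
Definition beta mu lambda z s : R[i] :=
  lim ((q_nest mu lambda n s z : R[i]^o) @[n --> \oo]).

Fixpoint tau mu lambda z (n : nat) s : R[i] :=
  if n is n'.+1 then
    clog mu (1 + tau mu lambda z n' (s + 1) / beta mu lambda z (s + 1))
    - clog mu (1 + cexp (- (lambda * s)))
  else 0.

Definition cderive (j : nat) a : R[i] -> R[i] :=
  derive1n j (a : R[i]^o -> R[i]^o).

(* Holomorphy near c, with the complex derivatives of every order (which the
   Taylor coefficients refer to) made explicit. *)
Definition holomorphic_near a c : Prop :=
  \forall s \near (c : R[i]^o),
    forall j : nat, derivable (cderive j a : R[i]^o -> R[i]^o) s 1.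

(* iota_m about c, as a polynomial in the increment from c. *)
Definition taylor (m : nat) a c : {poly R[i]} :=
  \poly_(j < m.+1) (cderive j a c / (j`!)%:R).

(* The norm ||a(s + k)||_{N,m} is [taylor_norm N s0 m a (s0 + k)]: the Taylor
   polynomial is taken about c = s0 + k, while its increment s - s0 runs over
   N - s0. It takes the value +oo when a is not holomorphic near c, where the
   Taylor polynomial is meaningless; finite values and limits are therefore only
   those of functions for which the norm is defined. *)
Definition taylor_norm N s0 (m : nat) a c : \bar R :=
  if `[< holomorphic_near a c >] then
    ereal_sup [set (cabs (taylor m a c).[s - s0])%:E | s in N]
  else +oo%E.

End Defs.

(* Main.v *)
Require Import Defs.
From mathcomp Require Import all_boot all_order all_algebra.
From mathcomp Require Import all_classical all_reals all_analysis.
From mathcomp Require Import complex ring lra.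
Import numFieldNormedType.Exports.
Import Order.TTheory GRing.Theory Num.Theory.

Local Open Scope classical_set_scope.
Local Open Scope ring_scope.

(** Write [g = 1 / (mu * beta)]. The iteration reads
    [tau (n+1) s = (ln (1 + mu * tau n (s+1) * g (s+1)) - ln (1 + e s)) / mu] with
    [e s = exp (- lambda * s)], so beta enters only through [g], and the
    finiteness of the limit [A] already says that [g] is holomorphic near [s0 + k]
    for large [k], with Taylor polynomials bounded on [N]. To first order one
    step multiplies [tau n (s+1)] by [g (s+1)] and adds a source of size
    [exp (- k Re lambda)] near [s0 + k]. After [n] steps the source met at
    [s0 + k + n] has been multiplied by about [A ^ n], while it is itself of size
    [exp (- (k + n) Re lambda)]: everything converges geometrically when
    [A < exp (Re lambda)].

    The supremum norm over [N] of a truncated product is not bounded by the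
    product of the norms, so this argument is run on Taylor coefficients, with the
    norm [jnorm], the sum of [|p j| * r ^ j] over [j <= m], which is
    submultiplicative for the product of jets. Boundedness on [N] bounds each
    coefficient of [g] uniformly in [k] ([coef_bound]), and the constant
    coefficient has modulus at most [A] up to an arbitrarily small error because
    [s0] belongs to [N]. A small weight [r] therefore makes the norm of every
    jet of [g] at most some [rho < exp (Re lambda)] ([jnorm_small_weight]).

    The logarithm costs nothing: near the origin it is Lipschitz on jets with a
    constant as close to 1 as desired ([log_jet_lipschitz]). Its constant
    coefficient is controlled by the complex logarithm near 1 ([cln_lipschitz]),
    the other ones by the recursion obtained from [(1 + u) f' = u'].
    In [tau_contraction] an induction on [n] gives that the jet of
    [tau n] at [s0 + k] has norm at most [D * exp (- k Re lambda)] for all large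
    [k], which keeps the arguments of the logarithms near 1, and a second one that
    its increments decrease geometrically in [n]. Convergence of the coefficients
    implies convergence in the norm over [N], as [|s - s0| <= 1] there. *)

(** * The modulus and the topology of the complex numbers *)

Section Modulus.
Local Open Scope complex_scope.
Set Implicit Arguments.
Unset Strict Implicit.
Variable R : realType.
Implicit Types (x y z c s : R[i]).

Lemma normE z : `|z| = (cabs z)%:C.
Proof. by []. Qed.

Lemma cabs_ge0 z : 0 <= cabs z.
Proof. by case: z => a b; rewrite /cabs /= sqrtr_ge0. Qed.

Lemma cabs0 : cabs (0 : R[i]) = 0.
Proof. exact: ComplexField.Normc.normc0. Qed.

Lemma cabs1 : cabs (1 : R[i]) = 1.
Proof. exact: ComplexField.Normc.normc1. Qed.

Lemma cabs_eq0 z : (cabs z == 0) = (z == 0).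
Proof.
apply/eqP/eqP => [|->]; last exact: cabs0.
exact: ComplexField.Normc.eq0_normc.
Qed.

Lemma cabs_gt0 z : (0 < cabs z) = (z != 0).
Proof. by rewrite lt_def cabs_ge0 andbT cabs_eq0. Qed.

Lemma cabsM x y : cabs (x * y) = cabs x * cabs y.
Proof. exact: ComplexField.Normc.normcM. Qed.

Lemma cabsV x : cabs x^-1 = (cabs x)^-1.
Proof. exact: ComplexField.Normc.normcV. Qed.

Lemma cabsN x : cabs (- x) = cabs x.
Proof. exact: normcN. Qed.

Lemma cabsD x y : cabs (x + y) <= cabs x + cabs y.
Proof. exact: le_normcD. Qed.

Lemma cabsB x y : cabs (x - y) = cabs (y - x).
Proof. by rewrite -cabsN opprB. Qed.

Lemma cabs_sum (I : Type) (r : seq I) (P : pred I) (F : I -> R[i]) :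
  cabs (\sum_(i <- r | P i) F i) <= \sum_(i <- r | P i) cabs (F i).
Proof.
elim/big_ind2: _ => [|x a y b xa yb|//]; first by rewrite cabs0.
by apply: (le_trans (cabsD _ _)); apply: lerD.
Qed.

Lemma cabsX x n : cabs (x ^+ n) = cabs x ^+ n.
Proof.
by elim: n => [|n ih]; rewrite ?expr0 ?cabs1// !exprS cabsM ih.
Qed.

Lemma cabs_real (r : R) : cabs (r%:C) = `|r|.
Proof. by rewrite /cabs /= expr0n addr0 sqrtr_sqr. Qed.

Lemma cabs_nat n : cabs (n%:R : R[i]) = n%:R.
Proof.
by rewrite -(rmorph_nat (real_complex R)) cabs_real ger0_norm.
Qed.

Lemma Re_le_cabs z : `|complex.Re z| <= cabs z.
Proof.
case: z => a b; rewrite /cabs /= -sqrtr_sqr ler_sqrt ?lerDl ?sqr_ge0//.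
by rewrite addr_ge0 ?sqr_ge0.
Qed.

Lemma Im_le_cabs z : `|complex.Im z| <= cabs z.
Proof.
case: z => a b; rewrite /cabs /= -sqrtr_sqr ler_sqrt ?lerDr ?sqr_ge0//.
by rewrite addr_ge0 ?sqr_ge0.
Qed.

Lemma cabs_le_ReIm z : cabs z <= `|complex.Re z| + `|complex.Im z|.
Proof.
rewrite [z in cabs z]complexE; apply: (le_trans (cabsD _ _)).
rewrite cabsM !cabs_real; suff -> : cabs ('i : R[i]) = 1 by rewrite mul1r.
by rewrite /cabs /= expr0n add0r expr1n sqrtr1.
Qed.


Lemma nbhs_cballP c (U : set R[i]) :
  nbhs (c : R[i]^o) U <->
  exists2 d : R, 0 < d & forall s, cabs (s - c) < d -> U s.
Proof.
split=> [/nbhs_ballP[e /= e0 h]|[d d0 h]].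
  have /complex_realP[d dE] : e \is Num.real by exact: gtr0_real.
  subst e; exists d; first by rewrite -ltcR.
  move=> s hs; apply: h; rewrite -ball_normE /=.
  by rewrite normE ltcR cabsB.
apply/nbhs_ballP; exists d%:C; rewrite /= ?ltcR// => s.
by rewrite -ball_normE /= normE ltcR cabsB => /h.
Qed.

(** The estimate form of differentiability combines directly with the estimates on
    the exponential and on the logarithm. *)
Lemma is_cderiveP (a : R[i] -> R[i]) s l :
  is_derive (s : R[i]^o) 1 (a : R[i]^o -> R[i]^o) l <->
  forall e : R, 0 < e -> exists2 d : R, 0 < d &
    forall h, cabs h < d -> cabs (a (h + s) - a s - l * h) <= e * cabs h.
Proof.
split=> [ha e e0|ha].
  have /cvgrPdist_le : (fun h : R[i]^o =>
      h^-1 *: (((a : R[i]^o -> R[i]^o) \o shift s) (h *: (1:R[i]^o)) - a s))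
     @ 0^' --> (l : R[i]^o).
    by have := @ex_derive _ _ _ _ _ _ _ ha; rewrite -(@derive_val _ _ _ _ _ _ _ ha).
  move=> /(_ e%:C); rewrite ltcR => /(_ e0).
  rewrite near_withinE => /nbhs_cballP[d d0 hd]; exists d => // h hh.
  have [->|h0] := eqVneq h 0.
    by rewrite add0r subrr mulr0 subr0 cabs0 mulr0.
  have := hd h; rewrite subr0 => /(_ hh h0) /=.
  rewrite [_ *: 1]mulr1 normE lecR => H.
  have -> : a (h + s) - a s - l * h = - ((l - h^-1 * (a (h + s) - a s)) * h).
    by rewrite mulrBl mulrAC mulVf// mul1r opprB.
  by rewrite cabsN cabsM ler_wpM2r// cabs_ge0.
have cv : (fun h : R[i]^o =>
    h^-1 *: (((a : R[i]^o -> R[i]^o) \o shift s) (h *: (1:R[i]^o)) - a s))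
     @ 0^' --> (l : R[i]^o).
  apply/cvgrPdist_le => e' e0.
  have /complex_realP[e eE] : e' \is Num.real by exact: gtr0_real.
  subst e'; rewrite ltcR in e0; have [d d0 hd] := ha e e0.
  rewrite near_withinE; apply/nbhs_cballP; exists d => // h.
  rewrite subr0 => hh h0 /=.
  rewrite [_ *: 1]mulr1 normE lecR.
  have -> : l - h^-1 *: (a (h + s) - a s : R[i]^o)
    = - ((a (h + s) - a s - l * h) * h^-1).
    by rewrite mulrBl mulfK// opprB [_ *: _]mulrC.
  rewrite cabsN cabsM cabsV ler_pdivrMr ?cabs_gt0//; exact: hd.
by apply: DeriveDef; [apply/cvg_ex; exists l|exact: (cvg_lim _ cv)].
Qed.

End Modulus.

(** * Exponential and logarithm *)

Section ExpLog.
Local Open Scope complex_scope.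
Set Implicit Arguments.
Unset Strict Implicit.
Variable R : realType.
Arguments cabs : simpl never.
Implicit Types (z w h u v : R[i]) (e d : R).

Lemma is_derive0_linear (f : R -> R) (l : R) : is_derive (0:R) 1 f l ->
  forall e, 0 < e -> exists2 d, 0 < d &
    forall x, `|x| < d -> `|f x - f 0 - l * x| <= e * `|x|.
Proof.
move=> hf e e0.
have /cvgrPdist_le : (fun h : R => h^-1 *: ((f \o shift 0) (h *: (1:R)) - f 0))
     @ 0^' --> l.
  by have := @ex_derive _ _ _ _ _ _ _ hf; rewrite -(@derive_val _ _ _ _ _ _ _ hf).
move=> /(_ e e0).
rewrite near_withinE => /nbhs_ballP[d /= d0 hd]; exists d => // t ht.
have [->|t0] := eqVneq t 0.
  by rewrite subrr mulr0 subr0 normr0 mulr0.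
have := hd t; rewrite -ball_normE /= sub0r normrN => /(_ ht t0) /=.
rewrite [_ *: 1]mulr1 addr0 => H.
have -> : f t - f 0 - l * t = - ((l - t^-1 * (f t - f 0)) * t).
  by rewrite mulrBl mulrAC mulVf// mul1r opprB.
by rewrite normrN normrM ler_wpM2r.
Qed.

Lemma continuous_epsilon (f : R -> R) (a : R) : {for a, continuous f} ->
  forall e, 0 < e -> exists2 d, 0 < d &
    forall x, `|x - a| < d -> `|f x - f a| <= e.
Proof.
move=> /cvgrPdist_le hf e e0; have /nbhs_ballP[d /= d0 hd] := hf e e0.
exists d => // x hx; rewrite distrC; apply: hd.
by rewrite -ball_normE /= distrC.
Qed.

Lemma cexpD (x y : R[i]) : cexp (x + y) = cexp x * cexp y.
Proof.
case: x => a b; case: y => c d; rewrite /cexp /= expRD cosD sinD.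
apply/eqP; rewrite eq_complex /=; apply/andP; split; apply/eqP; ring.
Qed.

Lemma cexp0 : cexp 0 = 1 :> R[i].
Proof. by rewrite /cexp /= expR0 cos0 sin0 mul1r. Qed.

Lemma cabs_cexp z : cabs (cexp z) = expR (complex.Re z).
Proof.
rewrite /cexp cabsM cabs_real ger0_norm ?expR_ge0//.
by rewrite /cabs /= cos2Dsin2 sqrtr1 mulr1.
Qed.

Lemma cexp_natM n z : cexp (n%:R * z) = cexp z ^+ n.
Proof.
elim: n => [|n ih]; first by rewrite mul0r cexp0 expr0.
by rewrite -addn1 natrD mulrDl mul1r cexpD ih exprD expr1.
Qed.

(** The real and imaginary parts of [cexp h - 1 - h] are combinations of the first
    order errors of [expR], [cos] and [sin] at 0 and of a quadratic term. *)
Lemma cexp_linear (e : R) : 0 < e -> exists2 d : R, 0 < d &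
  forall h, cabs h < d -> cabs (cexp h - 1 - h) <= e * cabs h.
Proof.
move=> e0; pose e' := Num.min 1 (e / 5).
have e'0 : 0 < e' by rewrite lt_min ltr01 divr_gt0.
have e'1 : e' <= 1 by rewrite ge_min lexx.
have e'e : 5 * e' <= e.
  by rewrite mulrC -ler_pdivlMr// ge_min lexx orbT.
have [d1 d10 h1] := is_derive0_linear (is_derive_expR (0:R)) e'0.
have [d2 d20 h2] := is_derive0_linear (is_derive_cos (0:R)) e'0.
have [d3 d30 h3] := is_derive0_linear (is_derive_sin (0:R)) e'0.
exists (Num.min (Num.min d1 d2) (Num.min d3 (e' / 4))).
  by rewrite !lt_min d10 d20 d30 divr_gt0.
move=> [x y]; set h := x +i* y; rewrite !lt_min => /andP[/andP[hd1 hd2] /andP[hd3 hd4]].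
have xh : `|x| <= cabs h := Re_le_cabs h.
have yh : `|y| <= cabs h := Im_le_cabs h.
have := h1 x (le_lt_trans xh hd1); rewrite expR0 mul1r.
have := h2 y (le_lt_trans yh hd2); rewrite cos0 sin0 oppr0 mul0r subr0.
have := h3 y (le_lt_trans yh hd3); rewrite sin0 cos0 mul1r subr0.
set E := expR x; set S := sin y; set C := cos y => hS hC hE.
have H0 := cabs_ge0 h.
have e'h (t : R) : `|t| <= cabs h -> e' * `|t| <= e' * cabs h.
  by move=> ?; rewrite ler_wpM2l// ltW.
have hE1 : `|E - 1 - x| <= e' * cabs h := le_trans hE (e'h _ xh).
have hC1 : `|C - 1| <= e' * cabs h := le_trans hC (e'h _ yh).
have hS1 : `|S - y| <= e' * cabs h := le_trans hS (e'h _ yh).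
have hE2 : `|E - 1| <= 2 * cabs h.
  rewrite -(subrK x (E - 1)); apply: (le_trans (ler_normD _ _)).
  have : e' * cabs h <= cabs h by rewrite ler_piMl.
  lra.
have hS2 : `|S| <= 2 * cabs h.
  rewrite -(subrK y S); apply: (le_trans (ler_normD _ _)).
  have : e' * cabs h <= cabs h by rewrite ler_piMl.
  lra.
have hE3 : `|E| <= 2.
  rewrite -(subrK 1 E); apply: (le_trans (ler_normD _ _)).
  by rewrite normr1; lra.
apply: (le_trans (cabs_le_ReIm _)).
have -> : cexp h - 1 - h = (E * C - 1 - x) +i* (E * S - y).
  apply/eqP; rewrite eq_complex /= -/E -/S -/C.
  by apply/andP; split; apply/eqP; ring.
rewrite /=.
have -> : E * C - 1 - x = (E - 1 - x) + E * (C - 1) by ring.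
have -> : E * S - y = (E - 1) * S + (S - y) by ring.
have b1 : `|E * (C - 1)| <= 2 * (e' * cabs h) by rewrite normrM ler_pM.
have b2 : `|(E - 1) * S| <= e' * cabs h.
  rewrite normrM; apply: le_trans (ler_pM _ _ hE2 hS2) _ => //.
  rewrite -subr_ge0 (_ : _ - _ = 4 * (cabs h * (e' / 4 - cabs h))); last by field.
  by rewrite mulr_ge0// mulr_ge0// subr_ge0 ltW.
apply: (@le_trans _ _ (5 * e' * cabs h)); last by rewrite ler_wpM2r.
apply: (le_trans (lerD (ler_normD _ _) (ler_normD _ _))).
rewrite (_ : 5 * e' * cabs h = (e' * cabs h + 2 * (e' * cabs h)) +
  (e' * cabs h + e' * cabs h)); last by ring.
by do !apply: lerD.
Qed.

Lemma is_cderive_cexp z : is_derive (z : R[i]^o) 1 (@cexp R : R[i]^o -> R[i]^o) (cexp z).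
Proof.
apply/is_cderiveP => e e0.
have cz : 0 < expR (complex.Re z) by exact: expR_gt0.
have [d d0 hd] := cexp_linear (divr_gt0 e0 cz); exists d => // h hh.
rewrite cexpD (_ : _ - _ = cexp z * (cexp h - 1 - h)); last by ring.
rewrite cabsM cabs_cexp; apply: (le_trans (ler_wpM2l _ (hd h hh))).
  exact: ltW.
by rewrite [leLHS](_ : _ = e * cabs h)//; field; rewrite gt_eqF.
Qed.

(** Half-angle formulas: [t = tan (arg w / 2)] equals [Im w / (|w| + Re w)], and
    [1 + t ^ 2 = 2 |w| / (|w| + Re w)]. *)
Lemma cexp_cln w : 0 < complex.Re w -> cexp (cln w) = w.
Proof.
case: w => x y /= x0; rewrite /cexp /cln /carg /=.
rewrite [x < 0]ltNge (ltW x0) andbF /=.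
set w := x +i* y.
have w0 : 0 < cabs w.
  by rewrite cabs_gt0 eq_complex /= (gt_eqF x0).
rewrite lnK ?posrE//.
set t := y / (cabs w + x).
have s0 : 0 < cabs w + x by rewrite addr_gt0.
have w2 : cabs w ^+ 2 = x ^+ 2 + y ^+ 2.
  by rewrite /cabs /= sqr_sqrtr// addr_ge0 ?sqr_ge0.
have ct : cos (atan t) ^+ 2 = (1 + t ^+ 2)^-1.
  by rewrite cos_atan exprVn sqr_sqrtr// addr_ge0 ?sqr_ge0.
have tt : 0 < 1 + t ^+ 2 by rewrite ltr_wpDr ?sqr_ge0.
have c0 : cos (atan t) != 0.
  by rewrite -sqrf_eq0 ct invr_eq0 gt_eqF.
have st : sin (atan t) = t * cos (atan t).
  by rewrite -[t in t * _]atanK /tan mulfVK.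
have tE : 1 + t ^+ 2 = 2 * cabs w / (cabs w + x).
  have y2 : y ^+ 2 = cabs w ^+ 2 - x ^+ 2 by rewrite w2 addrAC subrr add0r.
  by rewrite /t expr_div_n y2; field; rewrite gt_eqF.
have -> : 2 * atan t = atan t + atan t by ring.
rewrite cosD sinD st.
have c2 : cos (atan t) * cos (atan t) = (cabs w + x) / (2 * cabs w).
  by rewrite -expr2 ct tE invf_div.
apply/eqP; rewrite eq_complex /= !mul0r subr0 addr0; apply/andP; split; apply/eqP.
  rewrite (_ : _ - _ = cos (atan t) * cos (atan t) * (1 - t ^+ 2)); last by ring.
  have -> : 1 - t ^+ 2 = 2 - (1 + t ^+ 2) by ring.
  rewrite c2 tE.
  by field; rewrite !gt_eqF.
rewrite (_ : _ + _ = 2 * t * (cos (atan t) * cos (atan t))); last by ring.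
rewrite c2 /t; by field; rewrite !gt_eqF.
Qed.

Lemma cln1 : cln 1 = 0 :> R[i].
Proof.
by rewrite /cln /carg cabs1 ln1 /= mul0r atan0 mulr0 eqxx ltr10.
Qed.

Lemma cln_small (e : R) : 0 < e -> exists2 d : R, 0 < d &
  forall u, cabs u < d -> cabs (cln (1 + u)) <= e.
Proof.
move=> e0; have e20 : 0 < e / 2 by rewrite divr_gt0.
have e40 : 0 < e / 4 by rewrite divr_gt0.
have [d1 d10 h1] := continuous_epsilon (@continuous_ln R 1 ltr01) e20.
have [d2 d20 h2] := continuous_epsilon (@continuous_atan R 0) e40.
exists (Num.min (1 / 2) (Num.min d1 d2)).
  by rewrite !lt_min d10 d20 divr_gt0.
move=> u; rewrite !lt_min => /and3P[u1 u2 u3].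
have := Re_le_cabs u; have := Im_le_cabs u.
case: u u1 u2 u3 => x y; set u := x +i* y => u1 u2 u3 /= yu xu.
have x0 : 1 / 2 < 1 + x.
  move: xu; rewrite -/u ler_norml => /andP[? ?]. lra.
apply: (le_trans (cabs_le_ReIm _)).
rewrite /cln /carg /= add0r [1 + x < 0]ltNge (_ : 0 <= 1 + x); last by lra.
rewrite andbF /= (splitr e); apply: lerD.
  rewrite -[ln _]subr0 -[X in _ - X](@ln1 R); apply: h1.
  apply: le_lt_trans u2.
  rewrite ler_norml; apply/andP; split.
    have := cabsD (1 + u) (- u); rewrite addrK cabs1 cabsN; lra.
  have := cabsD 1 u; rewrite cabs1; lra.
rewrite normrM ger0_norm// mulrC -ler_pdivlMr// -mulrA -invfM -natrM.
rewrite -[atan _]subr0 -[X in _ - X](@atan0 R); apply: h2.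
rewrite subr0; apply: le_lt_trans u3; apply: le_trans yu.
have w1 : 1 / 2 <= cabs (1 + u).
  have := cabsD (1 + u) (- u); rewrite addrK cabs1 cabsN; lra.
have s1 : 1 <= cabs (1 + u) + (1 + x) by lra.
rewrite normrM normfV (ger0_norm (le_trans ler01 s1)).
by rewrite ler_piMr// invf_le1//; apply: lt_le_trans s1.
Qed.

(** Writing a point near 1 as the exponential of its logarithm, a difference of
    logarithms [k] satisfies [a - b = cexp g (cexp k - 1)], and
    [cexp k - 1] is [k] up to a small relative error; no mean value theorem is
    needed. *)
Lemma cln_lipschitz (e : R) : 0 < e -> exists2 d : R, 0 < d &
  forall u v, cabs u < d -> cabs v < d ->
    cabs (cln (1 + u) - cln (1 + v)) <= (1 + e) * cabs (u - v).
Proof.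
move=> e0; pose e1 := Num.min (1 / 16) (e / 8).
have e10 : 0 < e1 by rewrite lt_min !divr_gt0.
have e14 : e1 <= 1 / 16 by rewrite ge_min lexx.
have e1e : e1 <= e / 8 by rewrite ge_min lexx orbT.
clearbody e1.
have [d1 d10 h1] := cexp_linear e10.
have d13 : 0 < d1 / 3 by rewrite divr_gt0.
have [d2 d20 h2] := cln_small d13.
exists (Num.min d2 e1); first by rewrite lt_min d20.
move=> u v; rewrite !lt_min => /andP[u2 ue] /andP[v2 ve].
have Re0 w : cabs w < e1 -> 0 < complex.Re (1 + w).
  move=> we; have := Re_le_cabs w; case: w we => a b we /=; rewrite ler_norml => /andP[? ?]; lra.
set f := cln (1 + u); set g := cln (1 + v).
have ff : cexp f = 1 + u by apply: cexp_cln; apply: Re0.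
have gg : cexp g = 1 + v by apply: cexp_cln; apply: Re0.
have kd : cabs (f - g) < d1.
  apply: (le_lt_trans (cabsD _ _)); rewrite cabsN.
  have := h2 u u2; have := h2 v v2; rewrite -/f -/g; lra.
have := h1 _ kd; set k := f - g => hk.
have uv : u - v = (1 + v) * (cexp k - 1).
  have : cexp f = cexp g * cexp k by rewrite -cexpD /k addrC subrK.
  rewrite ff gg => E; rewrite mulrBr mulr1 -E; ring.
(* Solving [u - v = (1 + v) (cexp k - 1)] for [k] up to terms small against [k] *)
have kE : k = (u - v) - ((cexp k - 1 - k) + v * (cexp k - 1)).
  by rewrite uv; ring.
have K0 := cabs_ge0 k.
have b1 : cabs (cexp k - 1) <= 2 * cabs k.
  rewrite -(subrK k (cexp k - 1)); apply: (le_trans (cabsD _ _)).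
  have : e1 * cabs k <= cabs k by rewrite ler_piMl//; lra.
  lra.
have b2 : cabs (v * (cexp k - 1)) <= e1 * (2 * cabs k).
  by rewrite cabsM ler_pM ?cabs_ge0// ltW.
have : cabs k <= cabs (u - v) + (e1 * cabs k + e1 * (2 * cabs k)).
  rewrite {1}kE; apply: (le_trans (cabsD _ _)); rewrite cabsN lerD2l.
  by apply: (le_trans (cabsD _ _)); apply: lerD.
move=> H; have {}H : cabs k * (1 - 3 * e1) <= cabs (u - v) by lra.
have q0 : 0 < 1 - 3 * e1 by lra.
rewrite -ler_pdivlMr// in H; apply: (le_trans H).
rewrite mulrC ler_wpM2r ?cabs_ge0// -[_^-1]mul1r ler_pdivrMr//.
have : e1 * e <= 1 / 16 * e by rewrite ler_wpM2r// ltW.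
lra.
Qed.

(** The increment [k] of the logarithm from [w] to [w + h] satisfies
    [h / w = cexp k - 1], which is [k] up to [o(k)], and [k = O(h)] by
    [cln_lipschitz]. *)
Lemma is_cderive_cln : exists2 d : R, 0 < d & forall w, cabs (w - 1) < d ->
  is_derive (w : R[i]^o) 1 (@cln R : R[i]^o -> R[i]^o) w^-1.
Proof.
have [d1 d10 h1] := cln_lipschitz ltr01.
exists (Num.min (1 / 2) d1); first by rewrite lt_min d10 divr_gt0.
move=> w; rewrite lt_min => /andP[w2 w1].
apply/is_cderiveP => e e0.
have Re0 v : cabs (v - 1) < 1 / 2 -> 0 < complex.Re v.
  move=> we; have := Re_le_cabs (v - 1); case: v we => a b we /=.
  by rewrite ler_norml => /andP[? ?]; lra.
have w0 : w != 0.
  by apply/eqP => wE; have := Re0 w w2; rewrite wE ltxx.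
have e2 : 0 < e / 2 by rewrite divr_gt0.
have [d2 d20 h2] := cexp_linear e2.
pose r := Num.min (1 / 2) d1 - cabs (w - 1).
have r0 : 0 < r by rewrite subr_gt0 lt_min w2.
exists (Num.min r (d2 / 2)); first by rewrite lt_min r0 divr_gt0.
move=> h; rewrite lt_min => /andP[hr hd2].
have hw : cabs (h + w - 1) < Num.min (1 / 2) d1.
  rewrite -addrA; apply: (le_lt_trans (cabsD _ _)); move: hr; rewrite /r; lra.
move: hw; rewrite lt_min => /andP[hw2 hw1].
have := h1 (h + w - 1) (w - 1) hw1 w1.
have one t : 1 + (t - 1) = t :> R[i] by rewrite addrC subrK.
rewrite !one (_ : h + w - 1 - (w - 1) = h); last by ring.
set k := _ - _ => hk; have kd : cabs k < d2 by lra.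
have := h2 _ kd => H.
have E : w * cexp k = h + w.
  rewrite -{1}[w]cexp_cln ?Re0// -cexpD /k addrC subrK cexp_cln//; exact: Re0.
have -> : w^-1 * h = cexp k - 1.
  by apply: (mulfI w0); rewrite mulrA mulfV// mul1r mulrBr E mulr1 addrK.
rewrite cabsB; apply: (le_trans H).
have : e / 2 * cabs k <= e / 2 * ((1 + 1) * cabs h) by rewrite ler_wpM2l// ltW.
lra.
Qed.

End ExpLog.

(** * Complex differentiability of all orders *)

Section Smooth.
Local Open Scope complex_scope.
Set Implicit Arguments.
Unset Strict Implicit.
Variable R : realType.
Arguments cabs : simpl never.
Implicit Types (a b f g u : R[i] -> R[i]) (s c l k z w : R[i]) (U V : set R[i]^o).

Definition cdiff a s l : Prop :=
  is_derive (s : R[i]^o) 1 (a : R[i]^o -> R[i]^o) l.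

Lemma cdiff_val a s l : cdiff a s l ->
  'D_(1 : R[i]^o) (a : R[i]^o -> R[i]^o) s = l.
Proof. by move=> h; exact: (@derive_val _ _ _ _ _ _ _ h). Qed.

Lemma cdiffE a s l : cdiff a s l -> cderive 1 a s = l.
Proof. by move=> h; rewrite /cderive derive1n1 derive1E (cdiff_val h). Qed.

Lemma cdiff_derivable a s l : cdiff a s l ->
  derivable (a : R[i]^o -> R[i]^o) s 1.
Proof. by move=> h; exact: (@ex_derive _ _ _ _ _ _ _ h). Qed.

Lemma derivable_cdiff a s : derivable (a : R[i]^o -> R[i]^o) s 1 ->
  cdiff a s (cderive 1 a s).
Proof.
by move=> h; rewrite /cderive derive1n1 derive1E; exact: derivableP.
Qed.

Lemma cdiff_eq a s l l' : cdiff a s l -> l = l' -> cdiff a s l'.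
Proof. by move=> ? <-. Qed.

Lemma cdiff_ext a b s l : (\forall x \near (s : R[i]^o), a x = b x) ->
  cdiff a s l -> cdiff b s l.
Proof.
move=> /nbhs_cballP[d0 d00 hd0] /is_cderiveP h; apply/is_cderiveP => e e0.
have [d d1 hd] := h e e0; exists (Num.min d0 d); first by rewrite lt_min d00.
move=> x; rewrite lt_min => /andP[x0 x1].
by rewrite -!hd0 ?subrr ?cabs0 ?addrK//; apply: hd.
Qed.

Lemma cdiff_cst k s : cdiff (fun=> k) s 0.
Proof. exact: is_derive_cst. Qed.

Lemma cdiff_id s : cdiff id s 1.
Proof. exact: is_derive_id. Qed.

Lemma cdiffD a b s l k : cdiff a s l -> cdiff b s k ->
  cdiff (fun x => a x + b x) s (l + k).
Proof. by move=> ha hb; exact: is_deriveD. Qed.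

Lemma cdiffM a b s l k : cdiff a s l -> cdiff b s k ->
  cdiff (fun x => a x * b x) s (l * b s + a s * k).
Proof.
move=> ha hb; apply: cdiff_eq (is_deriveM ha hb) _.
by rewrite addrC; congr (_ + _); exact: mulrC.
Qed.

Lemma cdiffV a s l : a s != 0 -> cdiff a s l ->
  cdiff (fun x => (a x)^-1) s (- l * ((a s)^-1 * (a s)^-1)).
Proof.
move=> h0 ha; have := @deriveV _ _ (a : R[i]^o -> R[i]^o) s 1 h0 (cdiff_derivable ha).
have := @derivableV _ _ (a : R[i]^o -> R[i]^o) s 1 h0 (cdiff_derivable ha).
move=> h1 h2; apply: cdiff_eq (derivable_cdiff h1) _.
rewrite /cderive derive1n1 derive1E h2 (cdiff_val ha) expr2 invfM.
by rewrite -[_ *: _]/(- _ * l) mulrC mulNr mulrN.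
Qed.

Lemma cdiff_comp a b s l k : cdiff a s l -> cdiff b (a s) k ->
  cdiff (fun x => b (a x)) s (k * l).
Proof.
move=> ha hb.
move: ha hb => /is_cderiveP ha /is_cderiveP hb; apply/is_cderiveP => e e0.
have L0 : 0 < cabs l + 1 by rewrite ltr_wpDl ?cabs_ge0.
have K0 : 0 < cabs k + 1 by rewrite ltr_wpDl ?cabs_ge0.
have [da da0 hda] := ha _ ltr01.
have [da' da'0 hda'] := ha (e / 2 / (cabs k + 1)) (divr_gt0 (divr_gt0 e0 (ltr0Sn _ 1)) K0).
have [db db0 hdb] := hb (e / 2 / (cabs l + 1)) (divr_gt0 (divr_gt0 e0 (ltr0Sn _ 1)) L0).
exists (Num.min (Num.min da da') (db / (cabs l + 1))).
  by rewrite !lt_min da0 da'0 divr_gt0.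
move=> h; rewrite !lt_min ltr_pdivlMr// => /andP[/andP[h1 h2] h3].
have H0 := cabs_ge0 h.
set D := a (h + s) - a s.
have hD : cabs D <= (cabs l + 1) * cabs h.
  rewrite -(subrK (l * h) D); apply: (le_trans (cabsD _ _)).
  by rewrite cabsM addrC mulrDl lerD2l; exact: hda.
have Db : cabs D < db by apply: le_lt_trans hD _; rewrite mulrC.
have aE : a (h + s) = D + a s by rewrite subrK.
rewrite (_ : _ - k * l * h = (b (D + a s) - b (a s) - k * D) + k * (D - l * h));
  last by rewrite aE; ring.
apply: (le_trans (cabsD _ _)).
rewrite [leRHS](_ : _ = e / 2 * cabs h + e / 2 * cabs h); last by field.
apply: lerD.
  apply: (le_trans (hdb _ Db)).
  have -> : e / 2 * cabs h = e / 2 / (cabs l + 1) * ((cabs l + 1) * cabs h).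
    by field; rewrite gt_eqF.
  by rewrite ler_wpM2l// ltW// !divr_gt0.
rewrite cabsM; apply: (le_trans (ler_wpM2l (cabs_ge0 k) (hda' _ h2))).
have -> : e / 2 * cabs h = (cabs k + 1) * (e / 2 / (cabs k + 1) * cabs h).
  by field; rewrite gt_eqF.
by rewrite ler_wpM2r ?lerDl// mulr_ge0// ltW// !divr_gt0.
Qed.

Lemma cdiff_continuous a s l : cdiff a s l ->
  {for (s : R[i]^o), continuous (a : R[i]^o -> R[i]^o)}.
Proof. by move=> /cdiff_derivable/derivable1_diffP/differentiable_continuous. Qed.

Lemma cderive0 a : cderive 0 a = a.
Proof. by []. Qed.

Lemma cderiveS j a : cderive j.+1 a = cderive 1 (cderive j a).
Proof. by []. Qed.

Lemma cderiveSn j a : cderive j.+1 a = cderive j (cderive 1 a).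
Proof. by rewrite /cderive derive1Sn derive1n1. Qed.

Lemma cderive1_ext a b s : (\forall x \near (s : R[i]^o), a x = b x) ->
  cderive 1 a s = cderive 1 b s.
Proof.
move=> ab; rewrite /cderive !derive1n1 !derive1E.
exact: (@near_eq_derive _ R[i]^o R[i]^o a b s 1).
Qed.

Lemma cderive_ext U a b : open U -> (forall s, U s -> a s = b s) ->
  forall j s, U s -> cderive j a s = cderive j b s.
Proof.
move=> oU ab; elim=> [|j ih] s Us; first by rewrite !cderive0 ab.
rewrite (cderiveS j a) (cderiveS j b); apply: cderive1_ext.
by have := open_nbhs_nbhs (conj oU Us); apply: filterS => x; exact: ih.
Qed.

(** A one-constructor type rather than a definition, so that proof search does not
    unfold it down to the differentiability of an iterated derivative. *)
Variant smooth_upto n U a : Prop := SmoothUpto of forall j, (j < n)%N ->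
  forall s, U s -> derivable (cderive j a : R[i]^o -> R[i]^o) s 1.

Definition smooth U a : Prop := forall n, smooth_upto n U a.

Lemma smooth_upto0 U a : smooth_upto 0 U a.
Proof. by split=> j; rewrite ltn0. Qed.

(** With [smooth_uptoSn], this turns closure of smoothness under an operation into
    an induction on the order: differentiate once, and recognize operations on
    functions of lower order. *)
Lemma smooth_uptoS n U a f : open U -> smooth_upto n U f ->
  (forall s, U s -> cdiff a s (f s)) -> smooth_upto n.+1 U a.
Proof.
move=> oU [sf] af; split=> -[|j] jn s Us; first exact: cdiff_derivable (af s Us).
rewrite cderiveSn; apply: (@cdiff_derivable _ _ (cderive 1 (cderive j f) s)).
apply: cdiff_ext (derivable_cdiff (sf j jn s Us)).
have := open_nbhs_nbhs (conj oU Us); apply: filterS => x Ux.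
apply: (cderive_ext oU) => // t Ut.
by rewrite (cdiffE (af t Ut)).
Qed.

Lemma smooth_uptoSn n U a : smooth_upto n.+1 U a ->
  (forall s, U s -> cdiff a s (cderive 1 a s)) /\ smooth_upto n U (cderive 1 a).
Proof.
move=> [h]; split=> [s Us|]; first exact: derivable_cdiff (h 0%N _ s Us).
by split=> j jn s Us; rewrite -cderiveSn; apply: h.
Qed.

Lemma smooth_uptoW n U a : smooth_upto n.+1 U a -> smooth_upto n U a.
Proof. by move=> [h]; split=> j jn; apply: h; apply: ltnW. Qed.

Lemma smooth_cdiff U a s : smooth U a -> U s -> cdiff a s (cderive 1 a s).
Proof. by move=> h Us; have [H _] := @smooth_uptoSn 0 U a (h 1%N); exact: H. Qed.

Lemma smooth_cderive U a : smooth U a -> smooth U (cderive 1 a).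
Proof. by move=> h n; have [] := @smooth_uptoSn n U a (h n.+1). Qed.

Lemma smooth_sub U V a : U `<=` V -> smooth V a -> smooth U a.
Proof. by move=> UV h n; have [hn] := h n; split=> j jn s /UV; exact: hn. Qed.

Lemma smooth_upto_cst n U k : open U -> smooth_upto n U (fun=> k).
Proof.
move=> oU; elim: n k => [*|n ih]; first exact: smooth_upto0.
move=> k.
apply: (smooth_uptoS oU (ih 0)) => s _; exact: cdiff_cst.
Qed.

Lemma smooth_uptoD n U a b : open U -> smooth_upto n U a ->
  smooth_upto n U b -> smooth_upto n U (fun x => a x + b x).
Proof.
move=> oU; elim: n a b => [*|n ih]; first exact: smooth_upto0.
move=> a b.
move=> /smooth_uptoSn[da sa] /smooth_uptoSn[db sb].
apply: (smooth_uptoS oU (ih _ _ sa sb)) => s Us.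
exact: cdiffD (da s Us) (db s Us).
Qed.

Lemma smooth_uptoM n U a b : open U -> smooth_upto n U a ->
  smooth_upto n U b -> smooth_upto n U (fun x => a x * b x).
Proof.
move=> oU; elim: n a b => [*|n ih]; first exact: smooth_upto0.
move=> a b sa sb.
have [da sa'] := smooth_uptoSn sa; have [db sb'] := smooth_uptoSn sb.
apply: (smooth_uptoS oU (smooth_uptoD oU (ih _ _ sa' (smooth_uptoW sb))
  (ih _ _ (smooth_uptoW sa) sb'))) => s Us.
exact: cdiffM (da s Us) (db s Us).
Qed.

Lemma smooth_uptoV n U a : open U -> (forall s, U s -> a s != 0) ->
  smooth_upto n U a -> smooth_upto n U (fun x => (a x)^-1).
Proof.
move=> oU a0; elim: n => [*|n ih]; first exact: smooth_upto0.
move=> sa.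
have [da sa'] := smooth_uptoSn sa; have sV := ih (smooth_uptoW sa).
have sN : smooth_upto n U (fun x => (-1) * cderive 1 a x).
  exact: (smooth_uptoM oU (@smooth_upto_cst n U (-1) oU) sa').
apply: (smooth_uptoS oU (smooth_uptoM oU sN (smooth_uptoM oU sV sV))) => s Us.
by rewrite mulN1r; exact: cdiffV (a0 s Us) (da s Us).
Qed.

Lemma smooth_upto_cln n U a : open U ->
  (forall s, U s -> cdiff (@cln R) (a s) (a s)^-1 /\ a s != 0) ->
  smooth_upto n U a -> smooth_upto n U (fun x => cln (a x)).
Proof.
move=> oU ha; case: n => [*|n sa]; first exact: smooth_upto0.
have [da sa'] := smooth_uptoSn sa.
have sV : smooth_upto n U (fun x => (a x)^-1).
  apply: (smooth_uptoV oU _ (smooth_uptoW sa)) => s Us.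
  by have [] := ha s Us.
apply: (smooth_uptoS oU (smooth_uptoM oU sV sa')) => s Us.
by apply: cdiff_comp (da s Us) _; have [] := ha s Us.
Qed.

Lemma cdiff_cexp_linear k s : cdiff (fun x => cexp (k * x)) s (k * cexp (k * s)).
Proof.
apply: cdiff_eq (cdiff_comp (cdiffM (cdiff_cst k s) (cdiff_id s))
  (is_cderive_cexp (k * s))) _.
by rewrite mul0r add0r mulr1 mulrC.
Qed.

Lemma smooth_upto_cexp n U k : open U -> smooth_upto n U (fun x => cexp (k * x)).
Proof.
move=> oU; elim: n => [*|n ih]; first exact: smooth_upto0.
apply: (smooth_uptoS oU (smooth_uptoM oU (@smooth_upto_cst n U k oU) ih)).
move=> s _; exact: cdiff_cexp_linear.
Qed.

Lemma cderive_cexp j k s :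
  cderive j (fun x => cexp (k * x)) s = k ^+ j * cexp (k * s).
Proof.
elim: j s => [|j ih] s; first by rewrite expr0 mul1r.
rewrite cderiveS (@cderive1_ext _ (fun x => k ^+ j * cexp (k * x))); last first.
  by near=> x; exact: ih.
have h := cdiffM (cdiff_cst (k ^+ j) s) (cdiff_cexp_linear k s).
by rewrite (cdiffE h) mul0r add0r mulrA exprSr.
Unshelve. all: by end_near. Qed.

Lemma cdiff_horner (T : {poly R[i]}) c s :
  cdiff (fun x => T.[x - c]) s (T^`().[s - c]).
Proof.
elim/poly_ind: T => [|T k ih].
  apply: cdiff_ext; last (rewrite deriv0 horner0; exact: (cdiff_cst 0)).
  by near=> x; rewrite horner0.
have hid : cdiff (fun x => x - c) s 1.
  by apply: cdiff_eq (cdiffD (cdiff_id s) (cdiff_cst (- c) s)) _; rewrite addr0.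
have := cdiffD (cdiffM ih hid) (cdiff_cst k s).
move/cdiff_ext => h; apply: cdiff_eq (h _ _) _.
  by near=> x; rewrite !hornerE.
rewrite derivMXaddC !hornerE; ring.
Unshelve. all: by end_near. Qed.

Lemma smooth_upto_horner n U (T : {poly R[i]}) c : open U ->
  smooth_upto n U (fun x => T.[x - c]).
Proof.
move=> oU; elim: n T => [*|n ih]; first exact: smooth_upto0.
move=> T.
apply: (smooth_uptoS oU (ih T^`())) => s _; exact: cdiff_horner.
Qed.

Lemma cderive_horner j (T : {poly R[i]}) c s :
  cderive j (fun x => T.[x - c]) s = (T^`(j)).[s - c].
Proof.
elim: j s => [|j ih] s; first by [].
rewrite cderiveS (@cderive1_ext _ (fun x => (T^`(j)).[x - c])); last first.
  by near=> x; exact: ih.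
by rewrite (cdiffE (cdiff_horner _ _ _)) derivnS.
Unshelve. all: by end_near. Qed.

Lemma cderive_shift j a k s : cderive j (fun x => a (x + k)) s = cderive j a (s + k).
Proof.
elim: j s => [//|j ih] s.
rewrite (cderiveS j (fun x => a (x + k))) (cderiveS j a).
have -> : cderive j (fun x => a (x + k)) = fun x => cderive j a (x + k).
  by apply/funext => x; exact: ih.
rewrite /cderive !derive1n1 /derive1.
by under eq_fun do rewrite -addrA.
Qed.

Lemma smooth_shift U a k : smooth [set s + k | s in U] a ->
  smooth U (fun x => a (x + k)).
Proof.
move=> h n; have [hn] := h n; split=> j jn s Us.
have : [set s + k | s in U] (s + k) by exists s.
move=> /(hn j jn)/derivable_cdiff/is_cderiveP H.
apply: (@cdiff_derivable _ _ (cderive j.+1 a (s + k))); apply/is_cderiveP => e e0.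
have [d d0 hd] := H e e0; exists d => // x xd.
by rewrite !cderive_shift -(addrA x s k); exact: hd.
Qed.

Lemma holomorphic_nearP a c : holomorphic_near a c <->
  exists U : set R[i]^o, [/\ open U, U c & smooth U a].
Proof.
split=> [|[U [oU Uc sU]]].
  rewrite /holomorphic_near -nbhs_nearE nbhsE => -[U [oU Uc] hU].
  by exists U; split=> // n; split=> j _ s /hU H; exact: H.
have := open_nbhs_nbhs (conj oU Uc); apply: filterS => s Us j.
by have [H] := sU j.+1; exact: H.
Qed.

(** Locked, so that Taylor coefficients of different functions are never compared
    by unfolding them to limits of difference quotients. *)
Definition tcoef : (R[i] -> R[i]) -> R[i] -> nat -> R[i] :=
  locked (fun a c j => cderive j a c / j`!%:R).

Lemma tcoefE a c j : tcoef a c j = cderive j a c / j`!%:R.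
Proof. by rewrite /tcoef -lock. Qed.

Definition cauchy_prod (K : pzSemiRingType) (p q : nat -> K) (n : nat) : K :=
  \sum_(i < n.+1) p i * q (n - i)%N.

Lemma taylorE m a c : taylor m a c = \poly_(j < m.+1) tcoef a c j.
Proof. by apply/polyP => j; rewrite !coef_poly tcoefE. Qed.

Lemma tcoef0 a c : tcoef a c 0 = a c.
Proof. by rewrite tcoefE cderive0 fact0 divr1. Qed.

Lemma tcoef_ext U a b c : open U -> U c -> (forall s, U s -> a s = b s) ->
  tcoef a c =1 tcoef b c.
Proof. by move=> oU Uc ab j; rewrite !tcoefE (cderive_ext oU ab). Qed.

Lemma tcoef_cst k c j : tcoef (fun=> k) c j = if j is 0%N then k else 0.
Proof.
case: j => [|j]; first by rewrite tcoef0.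
rewrite tcoefE cderiveSn; suff -> : cderive 1 (fun=> k) = fun=> 0.
  rewrite (_ : cderive j _ c = 0) ?mul0r//.
  elim: j c => [//|j ih] x; rewrite cderiveSn.
  suff -> : cderive 1 (fun=> 0 : R[i]) = fun=> 0 by [].
  by apply/funext => s; apply: cdiffE; exact: cdiff_cst.
by apply/funext => s; apply: cdiffE; exact: cdiff_cst.
Qed.

Lemma tcoef_cexp k c j :
  tcoef (fun x => cexp (k * x)) c j = k ^+ j / j`!%:R * cexp (k * c).
Proof. by rewrite tcoefE cderive_cexp mulrAC. Qed.

Lemma tcoef_horner (T : {poly R[i]}) c j : tcoef (fun x => T.[x - c]) c j = T`_j.
Proof.
rewrite tcoefE cderive_horner subrr horner_coef0 coef_derivn addn0 ffactnn.
by rewrite -[T`_j *+ _]mulr_natr mulfK// pnatr_eq0 -lt0n fact_gt0.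
Qed.

Lemma tcoef_shift a k c : tcoef (fun x => a (x + k)) c =1 tcoef a (c + k).
Proof. by move=> j; rewrite !tcoefE cderive_shift. Qed.

Lemma tcoefS U a f c : open U -> U c -> (forall s, U s -> cdiff a s (f s)) ->
  forall j, tcoef f c j = j.+1%:R * tcoef a c j.+1.
Proof.
move=> oU Uc af j; rewrite !tcoefE (cderiveSn j a) factS natrM invfM mulrCA.
rewrite mulVKf ?pnatr_eq0//; congr (_ / _).
by apply: (cderive_ext oU) => // s Us; rewrite (cdiffE (af s Us)).
Qed.

Lemma smooth_derivative U a : smooth U a ->
  exists2 f, (forall s, U s -> cdiff a s (f s)) & smooth U f.
Proof.
move=> sa; exists (cderive 1 a); last exact: smooth_cderive.
by move=> s Us; exact: smooth_cdiff sa Us.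
Qed.

Lemma smoothD U a b : open U -> smooth U a -> smooth U b ->
  smooth U (fun x => a x + b x).
Proof. by move=> oU sa sb n; exact: smooth_uptoD. Qed.

Lemma smoothM U a b : open U -> smooth U a -> smooth U b ->
  smooth U (fun x => a x * b x).
Proof. by move=> oU sa sb n; exact: smooth_uptoM. Qed.

Lemma smooth_cst U k : open U -> smooth U (fun=> k).
Proof. by move=> oU n; exact: smooth_upto_cst. Qed.

(** Here and in [tcoefM_eq] the result of the operation is a variable [f], so that
    the induction hypothesis applies to the derivative of [f] through the pointwise
    equation alone. *)
Lemma tcoefD_eq U a b f c : open U -> U c -> smooth U a -> smooth U b ->
  (forall s, f s = a s + b s) ->
  forall j, tcoef f c j = tcoef a c j + tcoef b c j.
Proof.
move=> oU Uc sa sb fE j; elim: j a b f sa sb fE => [|j ih] a b f sa sb fE.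
  by rewrite !tcoef0 fE.
have n0 : (j.+1%:R : R[i]) != 0 by rewrite pnatr_eq0.
have [a' da sa'] := smooth_derivative sa.
have [b' db sb'] := smooth_derivative sb.
have [f' fE'] : exists f', forall s, f' s = a' s + b' s.
  by exists (fun s => a' s + b' s).
have df s : U s -> cdiff f s (f' s).
  move=> Us; rewrite fE' (_ : f = fun s => a s + b s); last exact/funext.
  exact: cdiffD (da s Us) (db s Us).
have := ih _ _ _ sa' sb' fE'.
rewrite (tcoefS oU Uc df) (tcoefS oU Uc da) (tcoefS oU Uc db) -mulrDr.
by move/(mulfI n0).
Qed.

(** The Leibniz rule, by induction on the order from [(a b)' = a' b + a b']. *)
Lemma tcoefM_eq U a b f c : open U -> U c -> smooth U a -> smooth U b ->
  (forall s, f s = a s * b s) ->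
  forall j, tcoef f c j = cauchy_prod (tcoef a c) (tcoef b c) j.
Proof.
move=> oU Uc sa sb fE j; elim: j a b f sa sb fE => [|j ih] a b f sa sb fE.
  by rewrite /cauchy_prod big_ord1 !tcoef0 fE.
have n0 : (j.+1%:R : R[i]) != 0 by rewrite pnatr_eq0.
have [a' da sa'] := smooth_derivative sa.
have [b' db sb'] := smooth_derivative sb.
have [g gE] : exists g, forall s, g s = a' s * b s by exists (fun s => a' s * b s).
have [h hE] : exists h, forall s, h s = a s * b' s by exists (fun s => a s * b' s).
have [f' fE'] : exists f', forall s, f' s = g s + h s by exists (fun s => g s + h s).
have sg : smooth U g.
  by rewrite (_ : g = fun s => a' s * b s); [exact: smoothM|exact/funext].
have sh : smooth U h.
  by rewrite (_ : h = fun s => a s * b' s); [exact: smoothM|exact/funext].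
have df s : U s -> cdiff f s (f' s).
  move=> Us; rewrite fE' gE hE (_ : f = fun s => a s * b s); last exact/funext.
  exact: cdiffM (da s Us) (db s Us).
have := tcoefD_eq oU Uc sg sh fE' j.
rewrite (ih _ _ _ sa' sb gE) (ih _ _ _ sa sb' hE) (tcoefS oU Uc df) => E.
apply: (mulfI n0); apply: (etrans E); rewrite /cauchy_prod.
(* [j + 1 = i + (j + 1 - i)] splits the convolution of order [j + 1] *)
have split_weight (p q : nat -> R[i]) :
    j.+1%:R * (\sum_(i < j.+2) p i * q (j.+1 - i)%N) =
    \sum_(i < j.+1) i.+1%:R * p i.+1 * q (j - i)%N +
    \sum_(i < j.+1) p i * ((j - i).+1%:R * q (j - i).+1).
  rewrite mulr_sumr (eq_bigr (fun i : 'I_j.+2 =>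
      (i%:R * p i) * q (j.+1 - i)%N +
      p i * ((j.+1 - i)%N%:R * q (j.+1 - i)%N))); last first.
    move=> i _; rewrite -{1}(subnKC (leq_ord i)) natrD; ring.
  rewrite big_split /=; congr (_ + _).
    by rewrite big_ord_recl mul0r mul0r add0r.
  rewrite big_ord_recr /= subnn mul0r mulr0 addr0; apply: eq_bigr => i _.
  by rewrite subSn// -ltnS.
rewrite split_weight; congr (_ + _); apply: eq_bigr => i _.
  by rewrite (tcoefS oU Uc da).
by rewrite (tcoefS oU Uc db).
Qed.

Lemma tcoefD U a b c : open U -> U c -> smooth U a -> smooth U b ->
  forall j, tcoef (fun x => a x + b x) c j = tcoef a c j + tcoef b c j.
Proof. by move=> oU Uc sa sb; exact: (tcoefD_eq oU Uc sa sb). Qed.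

Lemma tcoefM U a b c : open U -> U c -> smooth U a -> smooth U b ->
  forall j, tcoef (fun x => a x * b x) c j = cauchy_prod (tcoef a c) (tcoef b c) j.
Proof. by move=> oU Uc sa sb; exact: (tcoefM_eq oU Uc sa sb). Qed.

Lemma tcoefZ U a k c : open U -> U c -> smooth U a ->
  forall j, tcoef (fun x => k * a x) c j = k * tcoef a c j.
Proof.
move=> oU Uc sa j; rewrite (tcoefM oU Uc (smooth_cst k oU) sa) /cauchy_prod.
rewrite big_ord_recl tcoef_cst subn0 big1 ?addr0// => i _.
by rewrite tcoef_cst mul0r.
Qed.

Lemma smooth_cln U u f : open U -> smooth U u ->
  (forall s, U s -> cdiff (@cln R) (1 + u s) (1 + u s)^-1 /\ 1 + u s != 0) ->
  (forall s, f s = cln (1 + u s)) -> smooth U f.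
Proof.
move=> oU su hu fE; have -> : f = fun s => cln (1 + u s) by exact/funext.
by move=> n; apply: smooth_upto_cln => //; exact: smoothD (smooth_cst 1 oU) su n.
Qed.

(** Comparison of the coefficients in [f' + f' u = u']. *)
Lemma tcoef_cln U u f c : open U -> U c -> smooth U u ->
  (forall s, U s -> cdiff (@cln R) (1 + u s) (1 + u s)^-1 /\ 1 + u s != 0) ->
  (forall s, f s = cln (1 + u s)) ->
  forall j, j.+1%:R * tcoef f c j.+1 = j.+1%:R * tcoef u c j.+1 -
    \sum_(i < j.+1) i.+1%:R * tcoef f c i.+1 * tcoef u c (j - i).
Proof.
move=> oU Uc su hu fE j; have sf := smooth_cln oU su hu fE.
have ffun : f = fun s => cln (1 + u s) by exact/funext.
have [u' du su'] := smooth_derivative su.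
have [f' df sf'] := smooth_derivative sf.
have [g gE] : exists g, forall s, g s = f' s * u s by exists (fun s => f' s * u s).
have sg : smooth U g.
  by rewrite (_ : g = fun s => f' s * u s); [exact: smoothM|exact/funext].
have [v vE] : exists v, forall s, v s = f' s + g s by exists (fun s => f' s + g s).
have uv s : U s -> u' s = v s.
  move=> Us; have [dl n0] := hu s Us.
  have d1 := cdiffD (cdiff_cst 1 s) (du s Us).
  rewrite vE gE -(cdiffE (df s Us)) ffun (cdiffE (cdiff_comp d1 dl)) add0r.
  by rewrite -{1}[_^-1 * _]mulr1 -mulrDr mulrAC mulVf// mul1r.
have := tcoefD_eq oU Uc sf' sg vE j.
rewrite (tcoefM_eq oU Uc sf' su gE) -(tcoef_ext oU Uc uv).
rewrite (tcoefS oU Uc du) (tcoefS oU Uc df) => E.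
apply/eqP; rewrite eq_sym subr_eq; apply/eqP; apply: (etrans E).
by congr (_ + _); apply: eq_bigr => i _; rewrite (tcoefS oU Uc df).
Qed.

End Smooth.

(** * Weighted norms of jets *)

Section Jets.
Local Open Scope complex_scope.
Set Implicit Arguments.
Unset Strict Implicit.
Variable R : realType.
Arguments cabs : simpl never.
Implicit Types (p q u v f g : nat -> R[i]) (r : R) (A B : nat -> R) (m : nat).

Definition wsum m r A : R := \sum_(j < m.+1) A j * r ^+ j.

(** The l1 norm of a jet of order [m] with geometric weights: it is
    submultiplicative, and a small [r] makes the constant coefficient dominate. *)
Definition jnorm m r p : R := wsum m r (fun j => cabs (p j)).

Lemma wsum_le m r A B : 0 <= r -> (forall j, (j <= m)%N -> A j <= B j) ->
  wsum m r A <= wsum m r B.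
Proof.
move=> r0 AB; apply: ler_sum => j _.
by rewrite ler_wpM2r ?exprn_ge0// AB// -ltnS.
Qed.

Lemma wsumD m r A B :
  wsum m r (fun j => A j + B j) = wsum m r A + wsum m r B.
Proof. by rewrite -big_split; apply: eq_bigr => j _; rewrite mulrDl. Qed.

Lemma wsumZ m r k A : wsum m r (fun j => k * A j) = k * wsum m r A.
Proof. by rewrite [RHS]mulr_sumr; apply: eq_bigr => j _; rewrite mulrA. Qed.

Lemma cauchy_prod_ge0 A B n : (forall j, 0 <= A j) -> (forall j, 0 <= B j) ->
  0 <= cauchy_prod A B n.
Proof. by move=> A0 B0; apply: sumr_ge0 => i _; exact: mulr_ge0. Qed.

(** Both sides are values at [r] of polynomials with nonnegative coefficients, the
    left one being a truncation of the product on the right. *)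
Lemma wsum_cauchy_prod m r A B : 0 <= r -> (forall j, 0 <= A j) ->
  (forall j, 0 <= B j) -> wsum m r (cauchy_prod A B) <= wsum m r A * wsum m r B.
Proof.
move=> r0 A0 B0.
pose P := \poly_(j < m.+1) A j; pose Q := \poly_(j < m.+1) B j.
have cP j : 0 <= P`_j by rewrite coef_poly; case: ifP.
have cQ j : 0 <= Q`_j by rewrite coef_poly; case: ifP.
have -> : wsum m r A = P.[r] by rewrite horner_poly.
have -> : wsum m r B = Q.[r] by rewrite horner_poly.
rewrite -hornerM (@horner_coef_wide _ (m.+1 + size (P * Q))); last exact: leq_addl.
rewrite big_split_ord /=.
have -> : wsum m r (cauchy_prod A B) = \sum_(i < m.+1) (P * Q)`_i * r ^+ i.
  apply: eq_bigr => j _; congr (_ * _); rewrite coefM; apply: eq_bigr => i _.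
  rewrite !coef_poly (leq_trans (ltn_ord i) (ltn_ord j)).
  by rewrite (leq_ltn_trans (leq_subr _ _) (ltn_ord j)).
rewrite lerDl sumr_ge0// => i _.
by rewrite mulr_ge0 ?exprn_ge0// coefM sumr_ge0// => k _; exact: mulr_ge0.
Qed.

Lemma jnorm_ge0 m r p : 0 <= r -> 0 <= jnorm m r p.
Proof.
by move=> r0; apply: sumr_ge0 => j _; rewrite mulr_ge0 ?cabs_ge0 ?exprn_ge0.
Qed.

Lemma coef_le_jnorm m r p j : 0 <= r -> (j <= m)%N ->
  cabs (p j) * r ^+ j <= jnorm m r p.
Proof.
move=> r0 jm; rewrite /jnorm /wsum (bigD1 (Ordinal (jm : (j < m.+1)%N))) //=.
by rewrite lerDl sumr_ge0// => i _; rewrite mulr_ge0 ?cabs_ge0 ?exprn_ge0.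
Qed.

Lemma cabs0_le_jnorm m r p : 0 <= r -> cabs (p 0%N) <= jnorm m r p.
Proof. by move=> r0; have := coef_le_jnorm p r0 (leq0n m); rewrite expr0 mulr1. Qed.

Lemma eq_jnorm m r p q : p =1 q -> jnorm m r p = jnorm m r q.
Proof. by move=> pq; apply: eq_bigr => j _; rewrite pq. Qed.

Lemma jnorm0 m r : jnorm m r (fun=> 0) = 0.
Proof. by apply: big1 => j _; rewrite cabs0 mul0r. Qed.

Lemma jnormB m r p q : 0 <= r ->
  jnorm m r (fun j => p j - q j) <= jnorm m r p + jnorm m r q.
Proof.
move=> r0; rewrite -wsumD; apply: wsum_le => // j _.
by rewrite -(cabsN (q j)); exact: cabsD.
Qed.

Lemma jnormZ m r k p : jnorm m r (fun j => k * p j) = cabs k * jnorm m r p.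
Proof. by rewrite -wsumZ; apply: eq_bigr => j _; rewrite cabsM. Qed.

Lemma jnorm_cauchy_prod m r p q : 0 <= r ->
  jnorm m r (cauchy_prod p q) <= jnorm m r p * jnorm m r q.
Proof.
move=> r0; apply: le_trans (wsum_cauchy_prod m r0 (fun j => cabs_ge0 (p j))
  (fun j => cabs_ge0 (q j))); apply: wsum_le => // j _.
by apply: le_trans (cabs_sum _ _ _) _; apply: ler_sum => i _; rewrite cabsM.
Qed.

(** The relation between the jets of [u] and of [f = ln (1 + u)]; it determines [f],
    and in this implicit form no inverse of [1 + u] is needed. *)
Definition log_jet u f : Prop := f 0%N = cln (1 + u 0%N) /\
  forall j, j.+1%:R * f j.+1 =
    j.+1%:R * u j.+1 - \sum_(i < j.+1) i.+1%:R * f i.+1 * u (j - i)%N.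

Lemma log_jet0 : log_jet (fun=> 0) (fun=> 0).
Proof.
split; first by rewrite addr0 cln1.
by move=> j; rewrite mulr0 big1 ?subrr// => i _; rewrite mulr0.
Qed.

(** Divided by its index, the recursion for the coefficients of a logarithm carries
    weights [i / j <= 1]; so a product of jets bounds the difference, with no
    factor depending on the order. *)
Lemma log_jet_diff u v f g j : log_jet u f -> log_jet v g ->
  cabs (f j.+1 - g j.+1) <= cabs (u j.+1 - v j.+1) +
    (cauchy_prod (fun i => cabs (f i - g i)) (fun i => cabs (u i)) j.+1 +
     cauchy_prod (fun i => cabs (g i)) (fun i => cabs (u i - v i)) j.+1).
Proof.
move=> [_ hf] [_ hg].
have n0 : (j.+1%:R : R[i]) != 0 by rewrite pnatr_eq0.
have E : f j.+1 - g j.+1 = (u j.+1 - v j.+1) -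
    \sum_(i < j.+1) i.+1%:R / j.+1%:R * ((f i.+1 - g i.+1) * u (j - i)%N +
                                         g i.+1 * (u (j - i)%N - v (j - i)%N)).
  apply: (mulfI n0); rewrite mulrBr hf hg mulrBr mulr_sumr.
  set S1 := \sum_(i < _) _; set S2 := \sum_(i < _) _; set S := \sum_(i < _) _.
  suff -> : S = S1 - S2 by ring.
  rewrite /S /S1 /S2 -sumrB; apply: eq_bigr => i _.
  by rewrite mulrA mulrCA mulfV// mulr1; ring.
rewrite E; apply: (le_trans (cabsD _ _)); rewrite cabsN lerD2l.
apply: (le_trans (cabs_sum _ _ _)).
rewrite /cauchy_prod [X in _ <= X + _]big_ord_recl [X in _ <= _ + X]big_ord_recl /=.
rewrite addrACA -big_split /=; apply: ler_wpDl.
  by rewrite addr_ge0// mulr_ge0// cabs_ge0.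
apply: ler_sum => i _; rewrite /bump /= !add1n !subSS cabsM.
rewrite cabsM cabsV !cabs_nat.
apply: (@le_trans _ _ (1 * cabs ((f i.+1 - g i.+1) * u (j - i)%N +
                                 g i.+1 * (u (j - i)%N - v (j - i)%N)))).
  by rewrite ler_wpM2r ?cabs_ge0// ler_pdivrMr ?mul1r ?ltr0n// ler_nat.
by rewrite mul1r; apply: (le_trans (cabsD _ _)); rewrite !cabsM.
Qed.

(** The terms of second order in [log_jet_diff] have the small factors [|u|] and
    [|g|], and can be absorbed. The radius [d] depends neither on the order nor on
    the weight, which is what allows [r] to be fixed first. *)
Lemma log_jet_lipschitz (e : R) : 0 < e -> exists2 d : R, 0 < d &
  forall m r u v f g, 0 <= r -> log_jet u f -> log_jet v g ->
    jnorm m r u <= d -> jnorm m r v <= d ->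
    jnorm m r (fun j => f j - g j) <= (1 + e) * jnorm m r (fun j => u j - v j).
Proof.
move=> e0.
have [e' [e'0 e'1 e'e]] : exists e', [/\ 0 < e', e' <= 1 & e' <= e].
  by exists (Num.min 1 e); rewrite lt_min ltr01 e0 !ge_min !lexx orbT.
have e40 : 0 < e' / 4 by rewrite divr_gt0.
have [d0 d00 lip] := cln_lipschitz e40.
have [d [dpos dd0 de]] : exists d, [/\ 0 < d, d < d0 & d <= e' / 16].
  exists (Num.min (d0 / 2) (e' / 16)); split.
  - by rewrite lt_min !divr_gt0.
  - by apply: (@le_lt_trans _ _ (d0 / 2)); [rewrite ge_min lexx|lra].
  - by rewrite ge_min lexx orbT.
exists d => // m r u v f g r0 hf hg ud vd.
(* Applied first with [u = v] and [v = 0], to bound the norm of [g], and then to the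
   given jets *)
have main u1 v1 f1 g1 : log_jet u1 f1 -> log_jet v1 g1 ->
    jnorm m r u1 <= d -> jnorm m r v1 <= d ->
    jnorm m r (fun j => f1 j - g1 j) <=
      (1 + e' / 4) * jnorm m r (fun j => u1 j - v1 j) +
      (jnorm m r (fun j => f1 j - g1 j) * jnorm m r u1 +
       jnorm m r g1 * jnorm m r (fun j => u1 j - v1 j)).
  move=> h1 h2 u1d v1d.
  apply: (@le_trans _ _ (wsum m r (fun j => (1 + e' / 4) * cabs (u1 j - v1 j) +
     (cauchy_prod (fun i => cabs (f1 i - g1 i)) (fun i => cabs (u1 i)) j +
     cauchy_prod (fun i => cabs (g1 i)) (fun i => cabs (u1 i - v1 i)) j)))).
    apply: wsum_le => // -[|j] _.
      apply: ler_wpDr.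
        by apply: addr_ge0; apply: cauchy_prod_ge0 => i; exact: cabs_ge0.
      rewrite (proj1 h1) (proj1 h2); apply: (le_trans (lip _ _ _ _)).
      - exact: le_lt_trans (le_trans (cabs0_le_jnorm m u1 r0) u1d) dd0.
      - exact: le_lt_trans (le_trans (cabs0_le_jnorm m v1 r0) v1d) dd0.
      - by [].
    apply: (le_trans (log_jet_diff j h1 h2)); rewrite lerD2r.
    by rewrite ler_peMl ?cabs_ge0// lerDl ltW.
  rewrite !wsumD wsumZ lerD2l.
  by apply: lerD; apply: wsum_cauchy_prod => // j; exact: cabs_ge0.
have hg2 : jnorm m r g <= e' / 4.
  have := main v _ g _ hg log_jet0 vd; rewrite jnorm0 => /(_ (ltW dpos)).
  have -> : jnorm m r (fun j => g j - 0) = jnorm m r g.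
    by apply: eq_jnorm => j; rewrite subr0.
  have -> : jnorm m r (fun j => v j - 0) = jnorm m r v.
    by apply: eq_jnorm => j; rewrite subr0.
  rewrite mul0r addr0 => H.
  have g0 := jnorm_ge0 m g r0; have v0 := jnorm_ge0 m v r0.
  have : jnorm m r g * jnorm m r v <= jnorm m r g * (1 / 16).
    by rewrite ler_wpM2l//; lra.
  have : (1 + e' / 4) * jnorm m r v <= (1 + 1 / 4) * (e' / 16).
    by apply: ler_pM => //; lra.
  lra.
have := main u v f g hf hg ud vd.
set X := jnorm m r (fun j => f j - g j); set Y := jnorm m r (fun j => u j - v j).
have X0 : 0 <= X by exact: jnorm_ge0.
have Y0 : 0 <= Y by exact: jnorm_ge0.
have h1 : X * jnorm m r u <= X * (e' / 16) by rewrite ler_wpM2l//; lra.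
have h2 : jnorm m r g * Y <= e' / 4 * Y by rewrite ler_wpM2r.
move=> H; have {}H : X * (1 - e' / 16) <= (1 + e' / 2) * Y by lra.
have q0 : 0 < 1 - e' / 16 by lra.
rewrite -ler_pdivlMr// in H; apply: (le_trans H).
rewrite mulrAC ler_wpM2r// ler_pdivrMr//.
have : e' * e' <= e' * 1 by rewrite ler_wpM2l// ltW.
have : e' * (1 - e' / 16) <= e * (1 - e' / 16) by rewrite ler_wpM2r// ltW.
lra.
Qed.

(** Passing from [P] to [P (2 x) - 2 ^ (m + 1) P x] removes the leading term and
    multiplies each remaining coefficient by a number of modulus at least 1. *)
Lemma coef_bound m (d B : R) : 0 < d -> exists M : R, forall p,
  (forall x, cabs x <= d -> cabs (\sum_(j < m.+1) p j * x ^+ j) <= B) ->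
  forall j, (j <= m)%N -> cabs (p j) <= M.
Proof.
elim: m d B => [|m ih] d B d0.
  exists B => p hp j; rewrite leqn0 => /eqP ->.
  by have := hp 0; rewrite cabs0 big_ord1 expr0 mulr1 => /(_ (ltW d0)).
have d20 : 0 < d / 2 by rewrite divr_gt0.
have [M hM] := ih (d / 2) ((1 + 2 ^+ m.+1) * B) d20.
pose M' := (B + \sum_(j < m.+1) M * d ^+ j) / d ^+ m.+1.
exists (Num.max M M') => p hp j.
have low i : (i <= m)%N -> cabs (p i) <= M.
  move=> im; pose q i := (2 ^+ i - 2 ^+ m.+1) * p i.
  have hq x : cabs x <= d / 2 ->
      cabs (\sum_(j < m.+1) q j * x ^+ j) <= (1 + 2 ^+ m.+1) * B.
    move=> xd.
    have -> : \sum_(j < m.+1) q j * x ^+ j =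
        \sum_(j < m.+2) p j * (2 * x) ^+ j -
        2 ^+ m.+1 * \sum_(j < m.+2) p j * x ^+ j.
      rewrite mulr_sumr -sumrB [RHS]big_ord_recr /= exprMn [X in _ + X](_ : _ = 0) ?addr0.
        by apply: eq_bigr => k _; rewrite /q exprMn; ring.
      by ring.
    apply: (le_trans (cabsD _ _)); rewrite cabsN [leRHS]mulrDl mul1r; apply: lerD.
      by apply: hp; rewrite cabsM cabs_nat; lra.
    rewrite cabsM cabsX cabs_nat ler_wpM2l ?exprn_ge0//.
    by apply: hp; lra.
  apply: le_trans (hM q hq i im).
  rewrite /q cabsM ler_peMl ?cabs_ge0//.
  have -> : (2 ^+ i - 2 ^+ m.+1 : R[i]) = - ((2 ^ m.+1 - 2 ^ i)%N%:R).
    by rewrite natrB ?leq_exp2l ?(leq_trans im)// !natrX opprB.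
  rewrite cabsN cabs_nat ler1n subn_gt0 ltn_exp2l//.
rewrite leq_eqVlt => /orP[/eqP ->|jm]; last by rewrite le_max low.
rewrite le_max; apply/orP; right; rewrite ler_pdivlMr ?exprn_gt0//.
have cd : cabs (d%:C) = d by rewrite cabs_real ger0_norm// ltW.
have -> : cabs (p m.+1) * d ^+ m.+1 = cabs (p m.+1 * d%:C ^+ m.+1).
  by rewrite cabsM cabsX cd.
have := hp (d%:C); rewrite cd big_ord_recr /= => /(_ (lexx _)).
set S := \sum_(i < _) _ => H.
rewrite -(addKr S (_ * _)) addrC; apply: (le_trans (cabsD _ _)); apply: lerD => //.
rewrite cabsN; apply: (le_trans (cabs_sum _ _ _)); apply: ler_sum => i _.
by rewrite cabsM cabsX cd ler_wpM2r ?exprn_ge0 ?(ltW d0)// low// -ltnS.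
Qed.

End Jets.

(** * Germs of holomorphic functions *)

Section HolomorphicNear.
Local Open Scope complex_scope.
Set Implicit Arguments.
Unset Strict Implicit.
Variable R : realType.
Arguments cabs : simpl never.
Implicit Types (a b f g u : R[i] -> R[i]) (c k : R[i]).

Lemma holomorphic_near2 a b c : holomorphic_near a c -> holomorphic_near b c ->
  exists U : set R[i]^o, [/\ open U, U c, smooth U a & smooth U b].
Proof.
move=> /holomorphic_nearP[U [oU Uc sa]] /holomorphic_nearP[V [oV Vc sb]].
exists (U `&` V); split.
- exact: openI.
- by split.
- exact: smooth_sub sa.
- exact: smooth_sub sb.
Qed.

Lemma holomorphic_nearD a b c : holomorphic_near a c -> holomorphic_near b c ->
  holomorphic_near (fun s => a s + b s) c /\
  forall j, tcoef (fun s => a s + b s) c j = tcoef a c j + tcoef b c j.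
Proof.
move=> ha hb; have [U [oU Uc sa sb]] := holomorphic_near2 ha hb.
split; last exact: (tcoefD oU Uc sa sb).
by apply/holomorphic_nearP; exists U; split=> //; exact: smoothD.
Qed.

Lemma holomorphic_nearM a b c : holomorphic_near a c -> holomorphic_near b c ->
  holomorphic_near (fun s => a s * b s) c /\
  forall j, tcoef (fun s => a s * b s) c j =
    cauchy_prod (tcoef a c) (tcoef b c) j.
Proof.
move=> ha hb; have [U [oU Uc sa sb]] := holomorphic_near2 ha hb.
split; last exact: (tcoefM oU Uc sa sb).
by apply/holomorphic_nearP; exists U; split=> //; exact: smoothM.
Qed.

Lemma holomorphic_near_cst k c : holomorphic_near (fun=> k) c.
Proof.
apply/holomorphic_nearP; exists setT; split=> //; first exact: openT.
exact: smooth_cst openT.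
Qed.

Lemma holomorphic_nearZ k a c : holomorphic_near a c ->
  holomorphic_near (fun s => k * a s) c /\
  forall j, tcoef (fun s => k * a s) c j = k * tcoef a c j.
Proof.
move=> ha; have [h _] := holomorphic_nearM (holomorphic_near_cst k c) ha.
split=> //; have /holomorphic_nearP[U [oU Uc sa]] := ha.
exact: (tcoefZ k oU Uc sa).
Qed.

Lemma holomorphic_near_horner (T : {poly R[i]}) k c :
  holomorphic_near (fun s => T.[s - k]) c.
Proof.
apply/holomorphic_nearP; exists setT; split=> //; first exact: openT.
by move=> n; exact: smooth_upto_horner openT.
Qed.

Lemma holomorphic_near_cexp k c : holomorphic_near (fun s => cexp (k * s)) c.
Proof.
apply/holomorphic_nearP; exists setT; split=> //; first exact: openT.
by move=> n; exact: smooth_upto_cexp openT.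
Qed.

Lemma holomorphic_near_shift a k c : holomorphic_near a (c + k) ->
  holomorphic_near (fun s => a (s + k)) c.
Proof.
move=> /holomorphic_nearP[U [oU Uc sa]]; apply/holomorphic_nearP.
exists [set s | U (s + k)]; split=> //.
  apply: (@open_comp R[i]^o R[i]^o (fun s => s + k)) => // s _.
  exact: (cdiff_continuous (cdiffD (cdiff_id s) (cdiff_cst k s))).
by apply: smooth_shift; apply: smooth_sub sa => _ [s Us <-].
Qed.

(** The radius [d] does not depend on [u], so that one bound on values serves for
    all steps of the iteration. *)
Lemma holomorphic_near_cln : exists2 d : R, 0 < d & forall u f c,
  holomorphic_near u c -> cabs (u c) < d -> (forall s, f s = cln (1 + u s)) ->
  holomorphic_near f c /\ log_jet (tcoef u c) (tcoef f c).
Proof.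
have [d d0 hd] := @is_cderive_cln R.
exists (Num.min 1 d); first by rewrite lt_min ltr01.
move=> u f c /holomorphic_nearP[U [oU Uc su]] uc fE.
have cu := cdiff_continuous (smooth_cdiff su Uc).
have : \forall s \near (c : R[i]^o), U s /\ cabs (u s) < Num.min 1 d.
  near=> s; split; first by near: s; exact: open_nbhs_nbhs.
  near: s; apply: (cu [set w | cabs w < Num.min 1 d]).
  apply/nbhs_cballP; exists (Num.min 1 d - cabs (u c)); first by rewrite subr_gt0.
  move=> w hw; rewrite /= -(subrK (u c) w).
  by apply: (le_lt_trans (cabsD _ _)); rewrite -ltrBrDr.
rewrite -nbhs_nearE nbhsE => -[V [oV Vc] hV].
have sV : smooth V u by apply: smooth_sub su => s /hV[].
have hu s : V s -> cdiff (@cln R) (1 + u s) (1 + u s)^-1 /\ 1 + u s != 0.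
  move=> /hV[_]; rewrite lt_min => /andP[u1 ud]; split.
    by apply: hd; rewrite [1 + _]addrC addrK.
  apply/eqP => /eqP; rewrite addrC addr_eq0 => /eqP uE.
  by move: u1; rewrite uE cabsN cabs1 ltxx.
split.
  apply/holomorphic_nearP; exists V.
  by split; [exact: oV|exact: Vc|exact: smooth_cln oV sV hu fE].
split; first by rewrite !tcoef0 fE.
exact: (tcoef_cln oV Vc sV hu fE).
Unshelve. all: by end_near. Qed.

End HolomorphicNear.

(** * Sequences with geometric increments *)

Section Limits.
Local Open Scope complex_scope.
Set Implicit Arguments.
Unset Strict Implicit.
Variable R : realType.
Arguments cabs : simpl never.

Lemma geometric_increments_cvg (x : nat -> R) (B t : R) : 0 <= t < 1 ->
  (forall n, `|x n.+1 - x n| <= B * t ^+ n) -> cvgn x.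
Proof.
move=> /andP[t0 t1] hx.
have B0 : 0 <= B by have := le_trans (normr_ge0 _) (hx 0%N); rewrite expr0 mulr1.
have cs : cvgn (series (telescope x)).
  apply: normed_cvg; apply: (@series_le_cvg _ _ (geometric B t)).
  - by move=> n /=.
  - by move=> n /=; rewrite mulr_ge0// exprn_ge0.
  - by move=> n /=; exact: hx.
  - by apply: is_cvg_geometric_series; rewrite ger0_norm.
have -> : x = fun n => x 0%N + series (telescope x) n.
  by apply/funext => n; exact: eq_sum_telescope.
by apply: is_cvgD => //; exact: is_cvg_cst.
Qed.

(** Completeness is used on the real and imaginary parts separately. *)
Lemma geometric_increments_complex (x : nat -> R[i]) (B t : R) : 0 <= t < 1 ->
  (forall n, cabs (x n.+1 - x n) <= B * t ^+ n) ->
  exists l : R[i], (cabs (x n - l)) @[n --> \oo] --> 0.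
Proof.
move=> t01 hx.
have /cvg_ex[a ha] : cvgn (fun n => complex.Re (x n)).
  apply: (@geometric_increments_cvg _ B t) => // n.
  apply: le_trans (hx n); apply: le_trans (Re_le_cabs _).
  by case: (x n.+1) (x n) => ? ? [].
have /cvg_ex[b hb] : cvgn (fun n => complex.Im (x n)).
  apply: (@geometric_increments_cvg _ B t) => // n.
  apply: le_trans (hx n); apply: le_trans (Im_le_cabs _).
  by case: (x n.+1) (x n) => ? ? [].
exists (a +i* b).
apply: (@squeeze_cvgr _ _ _ _ (fun=> 0)
  (fun n => `|complex.Re (x n) - a| + `|complex.Im (x n) - b|)).
- near=> n; rewrite cabs_ge0 /=; apply: le_trans (cabs_le_ReIm _) _.
  by case: (x n).
- exact: cvg_cst.
- have -> : nbhs (0 : R) = nbhs (0 + 0 : R) by rewrite addr0.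
  apply: cvgD.
    rewrite -(normr0 R) -(subrr a); apply: cvg_norm; apply: cvgB => //; exact: cvg_cst.
  rewrite -(normr0 R) -(subrr b); apply: cvg_norm; apply: cvgB => //; exact: cvg_cst.
Unshelve. all: by end_near. Qed.

Lemma cvg_sum0 (m : nat) (F : nat -> nat -> R) :
  (forall j, (j < m)%N -> F j n @[n --> \oo] --> 0) ->
  (\sum_(j < m) F j n) @[n --> \oo] --> 0.
Proof.
elim: m => [|m ih] hF.
  by under eq_fun do rewrite big_ord0; exact: cvg_cst.
under eq_fun do rewrite big_ord_recr /=.
have -> : nbhs (0 : R) = nbhs (0 + 0 : R) by rewrite addr0.
apply: cvgD; last exact: hF.
by apply: ih => j jm; apply: hF; exact: ltnW.
Qed.

Lemma geometric_small (A t d : R) : 0 <= t < 1 -> 0 < d ->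
  exists K : nat, forall k, (K <= k)%N -> A * t ^+ k <= d.
Proof.
move=> /andP[t0 t1] d0.
have : (A * t ^+ k) @[k --> \oo] --> A * 0.
  by apply: cvgMr; apply: cvg_expr; rewrite ger0_norm.
rewrite mulr0 => /cvgr_le/(_ d d0)[K _ hK]; exists K => k Kk; exact: hK.
Qed.

End Limits.

(** * Contraction of the iteration *)

Section Contraction.
Local Open Scope complex_scope.
Set Implicit Arguments.
Unset Strict Implicit.
Variable R : realType.
Arguments cabs : simpl never.
Implicit Types (a b f g u e t : R[i] -> R[i]) (c mu : R[i]).

(** One step of the iteration on jets; [F] is the jet of the first logarithm, while
    that of the second one, which does not depend on [t], is kept explicit because
    it cancels in the difference of two steps. *)
Lemma tau_step : exists2 d : R, 0 < d & forall mu t t' g e c,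
  holomorphic_near t (c + 1) -> holomorphic_near g (c + 1) ->
  holomorphic_near e c ->
  cabs (mu * (t (c + 1) * g (c + 1))) < d -> cabs (e c) < d ->
  (forall s, t' s =
    mu^-1 * (cln (1 + mu * (t (s + 1) * g (s + 1))) - cln (1 + e s))) ->
  holomorphic_near t' c /\ exists2 F,
    log_jet (fun j => mu * cauchy_prod (tcoef t (c + 1)) (tcoef g (c + 1)) j) F &
    log_jet (tcoef e c) (tcoef (fun s => cln (1 + e s)) c) /\
    forall j, tcoef t' c j =
      mu^-1 * (F j - tcoef (fun s => cln (1 + e s)) c j).
Proof.
have [d d0 hd] := @holomorphic_near_cln R; exists d; first exact: d0.
move=> mu t t' g e c ht hg he ud ed t'E.
have ht1 := holomorphic_near_shift ht; have hg1 := holomorphic_near_shift hg.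
have [hp pE] := holomorphic_nearM ht1 hg1.
have [hu uE] := holomorphic_nearZ mu hp.
have [f fE] : exists f, forall s, f s = cln (1 + mu * (t (s + 1) * g (s + 1))).
  by exists (fun s => cln (1 + mu * (t (s + 1) * g (s + 1)))).
have [h hE] : exists h, forall s, h s = cln (1 + e s).
  by exists (fun s => cln (1 + e s)).
rewrite (_ : (fun s => cln (1 + e s)) = h); last by apply/funext => s; rewrite hE.
have [hf fJ] := hd _ _ _ hu ud fE.
have [hh hJ] := hd _ _ _ he ed hE.
have [hmh mhE] := holomorphic_nearZ (-1) hh.
have [hfh fhE] := holomorphic_nearD hf hmh.
have [ht' tE] := holomorphic_nearZ mu^-1 hfh.
have -> : t' = fun s => mu^-1 * (f s + -1 * h s).
  by apply/funext => s; rewrite t'E fE hE mulN1r.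
split; first exact: ht'.
exists (tcoef f c).
  rewrite (_ : (fun j => _) = tcoef (fun s => mu * (t (s + 1) * g (s + 1))) c); first exact: fJ.
  apply/funext => j; rewrite uE pE; congr (_ * _).
  by apply: eq_bigr => i _; rewrite !tcoef_shift.
by split; [exact: hJ|move=> j; rewrite tE fhE mhE mulN1r].
Qed.

(** With [theta] the midpoint of [rho * E] and 1, and Lipschitz constant
    [1 + ep = theta / (rho * E)] for the logarithm, one step maps the bound
    [D * E ^ (k+1)] at [s0 + k + 1] to
    [theta * D * E ^ k + (1 + ep) * C * E ^ k / |mu|] at [s0 + k], which is
    [D * E ^ k] for the chosen [D]. Taking [k] large keeps the arguments of both
    logarithms within the Lipschitz radius, for all [n] at once. *)
Lemma tau_contraction (m : nat) (r rho E C : R) (K0 : nat) (s0 mu : R[i])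
    (e g : R[i] -> R[i]) (t : nat -> R[i] -> R[i]) :
  0 < r -> 0 < rho -> 0 < E < 1 -> 0 <= C -> rho * E < 1 -> mu != 0 ->
  (forall k, (K0 <= k)%N -> holomorphic_near g (s0 + k%:R) /\
     jnorm m r (tcoef g (s0 + k%:R)) <= rho) ->
  (forall k : nat, holomorphic_near e (s0 + k%:R) /\
     jnorm m r (tcoef e (s0 + k%:R)) <= C * E ^+ k) ->
  t 0%N = (fun=> 0) ->
  (forall n s, t n.+1 s =
    mu^-1 * (cln (1 + mu * (t n (s + 1) * g (s + 1))) - cln (1 + e s))) ->
  exists (K : nat) (D theta : R), 0 <= theta < 1 /\
    forall k n, (K <= k)%N -> holomorphic_near (t n) (s0 + k%:R) /\
      jnorm m r (fun j => tcoef (t n.+1) (s0 + k%:R) j -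
                          tcoef (t n) (s0 + k%:R) j) <= D * theta ^+ n.
Proof.
move=> r0 rho0 /andP[E0 E1] C0 rE1 mu0 hg he t0 tS.
have rE0 : 0 < rho * E by exact: mulr_gt0.
pose theta := (1 + rho * E) / 2.
have th0 : 0 < theta by rewrite /theta; lra.
have th1 : theta < 1 by rewrite /theta; lra.
pose ep := theta / (rho * E) - 1.
have ep0 : 0 < ep by rewrite subr_gt0 ltr_pdivlMr// mul1r /theta; lra.
have thE : (1 + ep) * (rho * E) = theta.
  by rewrite /ep addrC subrK mulfVK// gt_eqF.
clearbody ep theta.
have [d1 d10 lip] := log_jet_lipschitz ep0.
have [d2 d20 step] := tau_step.
have cmu : 0 < cabs mu by rewrite cabs_gt0.
have [D DE] : exists D, D = (1 + ep) * C / (cabs mu * (1 - theta)) by eexists.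
have th1' : 0 < 1 - theta by rewrite subr_gt0.
have ep1 : 0 < 1 + ep by rewrite addr_gt0.
have D0 : 0 <= D by rewrite DE divr_ge0 ?mulr_ge0// ltW// mulr_gt0.
have [d [d0 dd1 dd2]] : exists d, [/\ 0 < d, d <= d1 & d < d2].
  exists (Num.min d1 (d2 / 2)); rewrite lt_min d10 divr_gt0// ge_min lexx; split=> //.
  by apply: (@le_lt_trans _ _ (d2 / 2)); [rewrite ge_min lexx orbT|lra].
have t01 : 0 <= E < 1 by rewrite ltW.
have [K1 hK1] := geometric_small (C + cabs mu * rho * D) t01 d0.
pose K := maxn K0 K1.
have mrD : 0 <= cabs mu * rho * D by exact: mulr_ge0 (mulr_ge0 (cabs_ge0 mu) (ltW rho0)) D0.
have small k : (K <= k)%N -> C * E ^+ k <= d /\ cabs mu * rho * D * E ^+ k <= d.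
  move=> Kk; have := hK1 k (leq_trans (leq_maxr _ _) Kk); rewrite mulrDl.
  have : 0 <= C * E ^+ k by rewrite mulr_ge0// exprn_ge0// ltW.
  have : 0 <= cabs mu * rho * D * E ^+ k by rewrite mulr_ge0// exprn_ge0// ltW.
  by split; lra.
have Eanti k : E ^+ k.+1 <= E ^+ k.
  by rewrite exprS ler_piMl ?exprn_ge0// ltW.
have nextE k : s0 + k%:R + 1 = s0 + k.+1%:R by rewrite -addrA -natr1.
pose U n k j := mu * cauchy_prod (tcoef (t n) (s0 + k.+1%:R)) (tcoef g (s0 + k.+1%:R)) j.
pose H k := tcoef (fun s => cln (1 + e s)) (s0 + k%:R).
have gK k : (K <= k)%N -> holomorphic_near g (s0 + k%:R) /\
     jnorm m r (tcoef g (s0 + k%:R)) <= rho.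
  by move=> Kk; apply: hg; exact: leq_trans (leq_maxl _ _) Kk.
have r0' := ltW r0.
have Ubound n k : (K <= k)%N ->
    jnorm m r (tcoef (t n) (s0 + k.+1%:R)) <= D * E ^+ k.+1 ->
    jnorm m r (U n k) <= cabs mu * rho * D * E ^+ k.+1.
  move=> Kk tb; rewrite jnormZ -!mulrA ler_wpM2l ?cabs_ge0//.
  apply: (le_trans (jnorm_cauchy_prod m _ _ r0')); rewrite mulrC.
  have [_ gb] := gK k.+1 (leqW Kk).
  by apply: ler_pM; [exact: jnorm_ge0|exact: jnorm_ge0|exact: gb|exact: tb].
have onestep n k : (K <= k)%N -> holomorphic_near (t n) (s0 + k.+1%:R) ->
    jnorm m r (tcoef (t n) (s0 + k.+1%:R)) <= D * E ^+ k.+1 ->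
    holomorphic_near (t n.+1) (s0 + k%:R) /\ exists2 F,
      log_jet (U n k) F & log_jet (tcoef e (s0 + k%:R)) (H k) /\
      forall j, tcoef (t n.+1) (s0 + k%:R) j = mu^-1 * (F j - H k j).
  move=> Kk tn tb; have [_ s2] := small k Kk.
  have [hgk _] := gK k.+1 (leqW Kk); have [hek ek] := he k.
  rewrite /U -nextE; apply: step.
  - by rewrite nextE; exact: tn.
  - by rewrite nextE; exact: hgk.
  - exact: hek.
  - rewrite nextE; apply: le_lt_trans dd2.
    apply: le_trans s2; apply: le_trans (ler_wpM2l mrD (Eanti k)).
    apply: le_trans (Ubound n k Kk tb); apply: le_trans (cabs0_le_jnorm m _ r0').
    by rewrite /U /cauchy_prod big_ord1 !tcoef0.
  - apply: le_lt_trans dd2; have [s1 _] := small k Kk; apply: le_trans s1.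
    by apply: le_trans ek; rewrite -(tcoef0 e); exact: cabs0_le_jnorm.
  - exact: tS.
have bound n : forall k, (K <= k)%N -> holomorphic_near (t n) (s0 + k%:R) /\
    jnorm m r (tcoef (t n) (s0 + k%:R)) <= D * E ^+ k.
  elim: n => [|n ih] k Kk.
    rewrite t0; split; first exact: holomorphic_near_cst.
    rewrite (@eq_jnorm _ _ _ _ (fun=> 0)); last by case=> [|j]; rewrite tcoef_cst.
    by rewrite jnorm0 mulr_ge0// exprn_ge0// ltW.
  have [hn bn] := ih k.+1 (leqW Kk); have [s1 s2] := small k Kk.
  have [hS [F FJ [HJ FE]]] := onestep n k Kk hn bn; split; first exact: hS.
  have Ub := Ubound n k Kk bn; have [_ ek] := he k.
  have Ud : jnorm m r (U n k) <= d1.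
    apply: le_trans dd1; apply: le_trans s2; apply: le_trans Ub _.
    exact: (ler_wpM2l mrD (Eanti k)).
  have ed : jnorm m r (tcoef e (s0 + k%:R)) <= d1.
    by apply: le_trans dd1; apply: le_trans s1.
  have z0 : jnorm m r (fun=> 0) <= d1 by rewrite jnorm0 ltW.
  have sub0 (p : nat -> R[i]) : jnorm m r (fun j => p j - 0) = jnorm m r p.
    by apply: eq_jnorm => j; rewrite subr0.
  have Fb := lip m r _ _ _ _ r0' FJ (log_jet0 R) Ud z0.
  have Hb := lip m r _ _ _ _ r0' HJ (log_jet0 R) ed z0.
  rewrite !sub0 in Fb Hb.
  rewrite (eq_jnorm m r FE) jnormZ cabsV.
  apply: (@le_trans _ _ ((cabs mu)^-1 * ((1 + ep) * (cabs mu * rho * D * E ^+ k.+1) +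
     (1 + ep) * (C * E ^+ k)))).
    rewrite ler_wpM2l ?invr_ge0 ?cabs_ge0//; apply: (le_trans (jnormB m _ _ r0')).
    apply: lerD.
      by apply: (le_trans Fb); rewrite ler_wpM2l// ltW.
    by apply: (le_trans Hb); rewrite ler_wpM2l// ltW.
  have CE : (1 + ep) * C = D * (cabs mu * (1 - theta)).
    by rewrite DE mulfVK// mulf_neq0// gt_eqF.
  rewrite [(1 + ep) * (C * _)]mulrA CE exprS.
  rewrite (_ : (1 + ep) * (_ * _) = cabs mu * ((1 + ep) * (rho * E)) * (D * E ^+ k));
    last by ring.
  rewrite thE le_eqVlt; apply/orP; left; apply/eqP.
  by field; rewrite gt_eqF.
exists K, D, theta; split; first by rewrite ltW.
have diff n : forall k, (K <= k)%N ->
    jnorm m r (fun j => tcoef (t n.+1) (s0 + k%:R) j - tcoef (t n) (s0 + k%:R) j)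
    <= D * E ^+ k * theta ^+ n.
  elim: n => [|n ih] k Kk.
    rewrite expr0 mulr1; have [_ b1] := bound 1%N k Kk; apply: le_trans b1.
    rewrite le_eqVlt; apply/orP; left; apply/eqP; apply: eq_jnorm => j.
    by rewrite t0 tcoef_cst; case: j => [|j]; rewrite subr0.
  have [h1 b1] := bound n k.+1 (leqW Kk).
  have [h2 b2] := bound n.+1 k.+1 (leqW Kk).
  have [_ [F FJ [_ FE]]] := onestep n k Kk h1 b1.
  have [_ [G GJ [_ GE]]] := onestep n.+1 k Kk h2 b2.
  have [s1 s2] := small k Kk.
  have Ud i : jnorm m r (tcoef (t i) (s0 + k.+1%:R)) <= D * E ^+ k.+1 ->
      jnorm m r (U i k) <= d1.
    move=> tb; apply: le_trans dd1; apply: le_trans s2.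
    apply: le_trans (Ubound i k Kk tb) _; exact: (ler_wpM2l mrD (Eanti k)).
  have L := lip m r _ _ _ _ r0' GJ FJ (Ud _ b2) (Ud _ b1).
  have UE : jnorm m r (fun j => U n.+1 k j - U n k j) <=
      cabs mu * (rho * (D * E ^+ k.+1 * theta ^+ n)).
    rewrite (@eq_jnorm _ _ _ _ (fun j => mu * cauchy_prod
      (fun i => tcoef (t n.+1) (s0 + k.+1%:R) i - tcoef (t n) (s0 + k.+1%:R) i)
      (tcoef g (s0 + k.+1%:R)) j)); last first.
      move=> j; rewrite /U -mulrBr -sumrB; congr (_ * _).
      by apply: eq_bigr => i _; rewrite mulrBl.
    rewrite jnormZ ler_wpM2l ?cabs_ge0//.
    apply: (le_trans (jnorm_cauchy_prod m _ _ r0')); rewrite mulrC.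
    have [_ gb] := gK k.+1 (leqW Kk).
    by apply: ler_pM; [exact: jnorm_ge0|exact: jnorm_ge0|exact: gb|exact: ih (leqW Kk)].
  rewrite (@eq_jnorm _ _ _ _ (fun j => mu^-1 * (G j - F j))); last first.
    by move=> j; rewrite GE FE; ring.
  rewrite jnormZ cabsV.
  apply: (@le_trans _ _ ((cabs mu)^-1 *
      ((1 + ep) * (cabs mu * (rho * (D * E ^+ k.+1 * theta ^+ n)))))).
    rewrite ler_wpM2l ?invr_ge0 ?cabs_ge0//; apply: (le_trans L).
    by rewrite ler_wpM2l// ltW.
  rewrite [E ^+ k.+1]exprS.
  rewrite (_ : (1 + ep) * _ =
    cabs mu * ((1 + ep) * (rho * E)) * (D * E ^+ k * theta ^+ n)); last by ring.
  rewrite thE [theta ^+ n.+1]exprS le_eqVlt; apply/orP; left; apply/eqP.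
  by field; rewrite gt_eqF.
move=> k n Kk; split; first by have [] := bound n k Kk.
apply: (le_trans (diff n k Kk)); rewrite ler_wpM2r ?exprn_ge0 ?(ltW th0)//.
by rewrite ler_piMr// exprn_ile1// ltW.
Qed.

End Contraction.

(** * The norm of Taylor polynomials *)

Section TaylorNorm.
Local Open Scope complex_scope.
Set Implicit Arguments.
Unset Strict Implicit.
Variable R : realType.
Arguments cabs : simpl never.
Implicit Types (a : R[i] -> R[i]) (c : R[i]).

Lemma horner_taylor m a c x :
  (taylor m a c).[x] = \sum_(j < m.+1) tcoef a c j * x ^+ j.
Proof. by rewrite taylorE horner_poly. Qed.

(** A norm bound on the Taylor polynomials controls all their coefficients; the
    constant one is bounded by the norm itself, as the centre belongs to [N]. *)
Lemma taylor_norm_bound (N : set R[i]) (s0 : R[i]) m (B : R) :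
  nbhs (s0 : R[i]^o) N -> exists M, forall a c,
    (taylor_norm N s0 m a c < B%:E)%E -> holomorphic_near a c /\
      cabs (tcoef a c 0) <= B /\ forall j, (j <= m)%N -> cabs (tcoef a c j) <= M.
Proof.
move=> /nbhs_cballP[d d0 hd].
have d20 : 0 < d / 2 by rewrite divr_gt0.
have [M hM] := coef_bound m B d20; exists M => a c.
rewrite /taylor_norm; case: asboolP => [ha|_]; last by rewrite ltNge leey.
move=> hB; split; first exact: ha.
have hp x : cabs x <= d / 2 -> cabs (\sum_(j < m.+1) tcoef a c j * x ^+ j) <= B.
  move=> xd; rewrite -horner_taylor -lee_fin; apply: le_trans (ltW hB).
  apply: ereal_sup_ubound; exists (x + s0); last by rewrite addrK.
  by apply: hd; rewrite addrK; lra.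
split; last exact: hM.
have := hp 0; rewrite cabs0 => /(_ (ltW d20)).
rewrite big_ord_recl expr0 mulr1 big1 ?addr0// => i _.
by rewrite exprS mul0r mulr0.
Qed.

(** Shrinking the weight brings the weighted norm of bounded jets as close as
    desired to the modulus of their constant term. *)
Lemma jnorm_small_weight m (B M eta : R) : B < eta ->
  exists r rho, [/\ 0 < r, rho < eta & forall p : nat -> R[i],
    cabs (p 0%N) <= B -> (forall j, (j <= m)%N -> cabs (p j) <= M) ->
    jnorm m r p <= rho].
Proof.
move=> Be; pose M' := Num.max M 0.
have M0 : 0 <= M' by rewrite le_max lexx orbT.
have MM : M <= M' by rewrite le_max lexx.
pose K := m%:R * M' + 1.
have K0 : 0 < K by rewrite ltr_wpDl// mulr_ge0.
pose r := Num.min 1 ((eta - B) / (2 * K)).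
have r0 : 0 < r by rewrite lt_min ltr01 divr_gt0 ?subr_gt0// mulr_gt0.
have r1 : r <= 1 by rewrite ge_min lexx.
have rK : r * (2 * K) <= eta - B.
  by rewrite -ler_pdivlMr ?mulr_gt0// ge_min lexx orbT.
exists r, (B + m%:R * (M' * r)); split=> //.
  have : m%:R * (M' * r) <= r * K by rewrite /K; lra.
  have : 0 < r * K by exact: mulr_gt0.
  lra.
move=> p p0 pM; rewrite /jnorm /wsum big_ord_recl expr0 mulr1; apply: lerD => //.
have -> : m%:R * (M' * r) = \sum_(i < m) (M' * r).
  by rewrite sumr_const card_ord mulr_natl.
apply: ler_sum => i _; apply: ler_pM; rewrite ?cabs_ge0 ?exprn_ge0 ?(ltW r0)//.
  by apply: le_trans MM; apply: pM; exact: ltn_ord.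
by rewrite /= exprS ler_piMr ?(ltW r0)// exprn_ile1// ltW.
Qed.

(** On [N] the increment has modulus at most 1, so the norm of the difference is at
    most the sum of the moduli of its coefficients. *)
Lemma taylor_norm_cvg (N : set R[i]) (s0 c : R[i]) m (t : nat -> R[i] -> R[i])
    (T : nat -> R[i]) :
  N s0 -> (forall s, N s -> cabs (s - s0) <= 1) ->
  (forall n, holomorphic_near (t n) c) ->
  (forall j, (j <= m)%N ->
    cabs (tcoef (t n) c j - T j) @[n --> \oo] --> 0) ->
  taylor_norm N s0 m (fun s => t n s - (\poly_(j < m.+1) T j).[s - c]) c
    @[n --> \oo] --> 0%E.
Proof.
move=> Ns0 N1 ht hT; set P := \poly_(j < m.+1) T j.
have hP := holomorphic_near_horner P c c.
have [hPN PNE] := holomorphic_nearZ (-1) hP.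
have dE n : (fun s => t n s - P.[s - c]) = fun s => t n s + -1 * P.[s - c].
  by apply/funext => s; rewrite mulN1r.
have hd n : holomorphic_near (fun s => t n s - P.[s - c]) c /\
    forall j, tcoef (fun s => t n s - P.[s - c]) c j = tcoef (t n) c j - P`_j.
  rewrite dE; have [h1 h2] := holomorphic_nearD (ht n) hPN.
  by split; [exact: h1|move=> j; rewrite h2 PNE tcoef_horner mulN1r].
apply: (@squeeze_cvge _ _ _ _ (fun=> 0%E) _
  (fun n => (\sum_(j < m.+1) cabs (tcoef (t n) c j - T j))%:E)); last 2 first.
- exact: cvg_cst.
- apply: cvg_EFin; first by near=> n.
  apply: (@cvg_sum0 R m.+1 (fun j n => cabs (tcoef (t n) c j - T j))) => j jm.
  exact: hT.
near=> n; have [hn cn] := hd n.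
rewrite /taylor_norm; case: asboolP => [_|/(_ hn)[]].
apply/andP; split.
  apply: (@le_trans _ _ (cabs (taylor m (fun s => t n s - P.[s - c]) c).[s0 - s0])%:E).
    by rewrite lee_fin cabs_ge0.
  by apply: ereal_sup_ubound; exists s0.
apply: ge_ereal_sup => _ [s Ns <-]; rewrite lee_fin horner_taylor.
apply: (le_trans (cabs_sum _ _ _)); apply: ler_sum => j _.
rewrite cn coef_poly ltn_ord cabsM cabsX ler_piMr ?cabs_ge0//.
by rewrite exprn_ile1 ?cabs_ge0// N1.
Unshelve. all: by end_near. Qed.

(** A translation multiplies an exponential by a constant, hence also its jets. *)
Lemma jnorm_tcoef_cexp m r (k s0 : R[i]) n :
  jnorm m r (tcoef (fun s => cexp (k * s)) (s0 + n%:R)) =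
  jnorm m r (tcoef (fun s => cexp (k * s)) s0) * expR (complex.Re k) ^+ n.
Proof.
rewrite mulrC -cabs_cexp -cabsX -jnormZ; apply: eq_jnorm => j.
by rewrite !tcoef_cexp mulrDr cexpD [k * n%:R]mulrC cexp_natM; ring.
Qed.

End TaylorNorm.

Theorem theorem4p4p6 (R : realType) (mu : R[i]) (hmu : mu != 0)
    (z : R[i]) (m : nat) (s0 lambda : R[i]) (hL : LL (s0, lambda))
    (N : set R[i]) (hN : nbhs (s0 : R[i]^o) N)
    (hN1 : forall s : R[i], N s -> cabs (s - s0) <= 1)
    (A : \bar R)
    (hA : taylor_norm N s0 m (fun s => 1 / (mu * beta mu lambda z s))
            (s0 + k%:R) @[k --> \oo] --> A)
    (hlambda : (lne A < (complex.Re lambda)%:E)%E) :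
  exists K : nat, forall k : nat, (K < k)%N ->
    exists2 T : {poly R[i]}, (size T <= m.+1)%N &
      taylor_norm N s0 m
        (fun s => tau mu lambda z n s - T.[s - (s0 + k%:R)])
        (s0 + k%:R) @[n --> \oo] --> 0%E.
Proof.
have [/= Re0 _] := hL.
set L := complex.Re lambda in Re0 hlambda.
set g := fun s => 1 / (mu * beta mu lambda z s) in hA.
have [B [B0 AB BL]] : exists B : R, [/\ 0 < B, (A < B%:E)%E & B < expR L].
  have e0 := expR_gt0 L.
  case: A hlambda {hA} => [a| |]//=.
  - have [a0 _|a0] := leP a 0.
      exists (expR L / 2); rewrite divr_gt0// lte_fin; split=> //.
        by apply: le_lt_trans a0 _; rewrite divr_gt0.
      by rewrite ltr_pdivrMr// ltr_pMr// ltr1n.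
    rewrite lte_fin => aL; have aE : a < expR L by rewrite -ltr_expR lnK in aL.
    exists ((a + expR L) / 2); rewrite lte_fin; split; lra.
  - move=> _; exists (expR L / 2); rewrite divr_gt0// ltNye; split=> //.
    by rewrite ltr_pdivrMr// ltr_pMr// ltr1n.
have [M hM] := taylor_norm_bound m B hN.
have [r [rho' [r0 rhoL hr]]] := jnorm_small_weight m M BL.
(* The maximum ensures that the contraction factor is positive *)
pose rho := Num.max rho' B.
have rho0 : 0 < rho by rewrite lt_max B0 orbT.
have rhoL' : rho < expR L by rewrite gt_max rhoL.
have [K0 _ hK0] : \forall k \near \oo,
    (taylor_norm N s0 m g (s0 + k%:R)%R < B%:E)%E.
  exact: (hA [set x | (x < B%:E)%E] (open_ereal_lt' AB)).
have hg k : (K0 <= k)%N -> holomorphic_near g (s0 + k%:R) /\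
    jnorm m r (tcoef g (s0 + k%:R)) <= rho.
  move=> Kk; have [hh [h0 hj]] := hM _ _ (hK0 k Kk); split; first exact: hh.
  by apply: le_trans (hr _ h0 hj) _; rewrite le_max lexx.
pose e := fun s => cexp (- lambda * s).
pose E := expR (- L).
have he k : holomorphic_near e (s0 + k%:R) /\
    jnorm m r (tcoef e (s0 + k%:R)) <= jnorm m r (tcoef e s0) * E ^+ k.
  split; first exact: holomorphic_near_cexp.
  by rewrite /e jnorm_tcoef_cexp /E /L raddfN.
have E01 : 0 < E < 1 by rewrite expR_gt0 expR_lt1 oppr_lt0.
have rE1 : rho * E < 1 by rewrite /E expRN ltr_pdivrMr ?expR_gt0// mul1r.
have C0 := jnorm_ge0 m (tcoef e s0) (ltW r0).
have t0 : tau mu lambda z 0 = (fun=> 0) by [].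
have tS n s : tau mu lambda z n.+1 s = mu^-1 *
    (cln (1 + mu * (tau mu lambda z n (s + 1) * g (s + 1))) - cln (1 + e s)).
  rewrite /= /clog /g /e mulNr -mulrBl mulrC div1r invfM.
  by rewrite [mu * _]mulrCA mulVKf.
have [K [D [th [th01 hK]]]] :=
  tau_contraction r0 rho0 E01 C0 rE1 hmu hg he t0 tS.
exists K => k Kk; set c := s0 + k%:R.
have coef_cvg j : exists l : R[i], (j <= m)%N ->
    cabs (tcoef (tau mu lambda z n) c j - l) @[n --> \oo] --> 0.
  have [jm|mj] := leqP j m; last by exists 0.
  have [l hl] : exists l : R[i],
      cabs (tcoef (tau mu lambda z n) c j - l) @[n --> \oo] --> 0.
    apply: (@geometric_increments_complex _ _ (D / r ^+ j) th th01) => n.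
    have [_ hn] := hK k n (ltnW Kk).
    rewrite mulrAC ler_pdivlMr ?exprn_gt0//.
    by apply: le_trans hn; exact: coef_le_jnorm (ltW r0) jm.
  by exists l.
have [T hT] := choice coef_cvg.
exists (\poly_(j < m.+1) T j); first exact: size_poly.
apply: taylor_norm_cvg => //.
- by apply: nbhs_singleton hN.
- by move=> n; have [] := hK k n (ltnW Kk).
Qed.
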